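(* Let $\Omega\subset\mathbb{R}^2$ be an open set of finite positive Lebesgue measure $V=|\Omega|$, and let $\lambda_1\le\lambda_2\le\cdots$ be the Dirichlet eigenvalues of $-\Delta$ on $\Omega$, repeated according to multiplicity. Let $y_2$ be the unique solution in $(1,\infty)$ of $$y-\log y=\frac32,$$ and define $$K_2=1+\log y_2=y_2-\frac12,\qquad c_2=K_2^{-1}.$$ Then, for every integer $k\geq1$, $$\lambda_k\geq c_2\,\frac{4\pi k}{V},\qquad c_2=0.5383068077\ldots.$$ In particular, the coefficient improves that of the bound $\lambda_k\ge 2\pi k/V$ (which corresponds to the coefficient $\tfrac12$ in place of $c_2$) by approximately $7.66\%$, i.e. $c_2/\tfrac12-1\approx 0.0766$.
   Context: The Dirichlet eigenvalues $0<\lambda_1\le\lambda_2\le\cdots\nearrow\infty$ are those of the Dirichlet Laplacian on $\Omega$, understood weakly: there is an orthonormal basis $\{\phi_j\}_{j\ge1}$ of $L^2(\Omega)$ with $\phi_j\in H_0^1(\Omega)$ and $\int_\Omega\nabla\phi_j\cdot\nabla v\,dx=\lambda_j\int_\Omega\phi_j v\,dx$ for all $v\in H_0^1(\Omega)$. No regularity of the boundary or connectedness of $\Omega$ is assumed. $\log$ is the natural logarithm. The notation $c_2=0.5383068077\ldots$ gives the leading decimal digits of $c_2$.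
   Formalization: The displayed value c_2=0.5383068077... is not the leading decimal expansion (c_2=0.53830680765...); the theorem proves it as the value rounded to ten decimals, |c_2-0.5383068077| <= 0.5*10^-10. *)

(* Defs.v *)
From HB Require Import structures.
From mathcomp Require Import all_boot all_order all_algebra.
From mathcomp Require Import all_classical all_reals all_analysis.

Set Implicit Arguments.
Unset Strict Implicit.
Unset Printing Implicit Defensive.

Import Order.TTheory GRing.Theory Num.Theory.
Import numFieldNormedType.Exports.

Local Open Scope classical_set_scope.
Local Open Scope ring_scope.

Section Plane.
Context {R : realType}.

(* The product measure lives on the product of the Borel sigma-algebras; every
   Lebesgue-measurable function agrees almost everywhere with a Borel one. *)
Definition leb2 : set (measurableTypeR R * measurableTypeR R) -> \bar R :=
  (@lebesgue_measure R \x @lebesgue_measure R)%E.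

HB.instance Definition _ := Measure.on leb2.

Implicit Types (Omega : set (R * R)) (f g u v psi : R * R -> R)
  (G H : 'I_2 -> R * R -> R).

Definition basis_vec (i : 'I_2) : R * R := if i == 0 then (1, 0) else (0, 1).

Definition partial (i : 'I_2) f : R * R -> R := fun x => 'D_(basis_vec i) f x.

(* A function with continuous partial derivatives of order one is C^1, so this
   is the usual class C^n on the plane. *)
Fixpoint Cn (n : nat) f : Prop :=
  continuous f /\
  if n is m.+1 then
    forall i, (forall x, derivable f x (basis_vec i)) /\ Cn m (partial i f)
  else True.

Definition test_function Omega psi : Prop :=
  [/\ forall n, Cn n psi,
      compact (closure [set x | psi x != 0]) &
      closure [set x | psi x != 0] `<=` Omega].

Definition L2 Omega f : Prop :=
  @measurable_fun _ _ (measurableTypeR R * measurableTypeR R)%type R Omega f /\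
  leb2.-integrable Omega (EFin \o (fun x => f x ^+ 2)).

Definition inner Omega f g : R := \int[leb2]_(x in Omega) (f x * g x).

(* Extended-real valued, so that an infinite norm is not read as zero. *)
Definition sqdist Omega f g : \bar R :=
  (\int[leb2]_(x in Omega) ((f x - g x) ^+ 2)%:E)%E.

Definition weak_gradient Omega u G : Prop :=
  forall psi, test_function Omega psi ->
    forall i, inner Omega u (partial i psi) = - inner Omega (G i) psi.

Definition H1 Omega u G : Prop :=
  [/\ L2 Omega u, forall i, L2 Omega (G i) & weak_gradient Omega u G].

(* The closure of the test functions in the H^1 norm.  The weak gradient,
   which is unique up to a null set, is carried as the argument [G]. *)
Definition H10 Omega u G : Prop :=
  H1 Omega u G /\
  exists psi : nat -> R * R -> R,
    [/\ forall n, test_function Omega (psi n),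
        sqdist Omega (psi n) u @[n --> \oo] --> 0%E &
        forall i, sqdist Omega (partial i (psi n)) (G i) @[n --> \oo] --> 0%E].

(* Families are indexed from 1; the value at index 0 plays no role. *)
Definition orthonormal_basis Omega (phi : nat -> R * R -> R) : Prop :=
  [/\ forall j, (0 < j)%N -> L2 Omega (phi j),
      forall i j, (0 < i)%N -> (0 < j)%N ->
        inner Omega (phi i) (phi j) = (i == j)%:R &
      forall f, L2 Omega f ->
        sqdist Omega
          (fun x => \sum_(1 <= j < n.+1) inner Omega f (phi j) * phi j x) f
          @[n --> \oo] --> 0%E].

Definition dirichlet_eigenvalues Omega (lambda : nat -> R) : Prop :=
  [/\ forall j, (0 < j)%N -> 0 < lambda j,
      forall i j, (0 < i)%N -> (i <= j)%N -> lambda i <= lambda j,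
      lambda j @[j --> \oo] --> +oo &
      exists (phi : nat -> R * R -> R) (dphi : nat -> 'I_2 -> R * R -> R),
        orthonormal_basis Omega phi /\
        forall j, (0 < j)%N ->
          H10 Omega (phi j) (dphi j) /\
          forall v dv, H10 Omega v dv ->
            \int[leb2]_(x in Omega) (\sum_(i < 2) dphi j i x * dv i x)
            = lambda j * inner Omega (phi j) v].

End Plane.

(* Main.v *)
Require Import Defs.
From mathcomp Require Import all_boot all_order all_algebra.
From mathcomp Require Import all_classical all_reals all_analysis.
From mathcomp Require Import measurable_realfun zify ring lra.

Set Implicit Arguments.
Unset Strict Implicit.
Unset Printing Implicit Defensive.

Import Order.TTheory GRing.Theory Num.Theory.
Import numFieldNormedType.Exports.

Local Open Scope classical_set_scope.
Local Open Scope ring_scope.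

(** Write [e_xi] for the complex wave [exp (i xi . x)], [hat] for the Fourier
transform of functions on Omega, and [F xi] for the sum of [|hat phi_j xi|^2]
over [j <= k], where [phi_j] are the eigenfunctions.  Put [L = lambda_k].

The numbers [<phi_j, e_xi>] are coefficients of [e_xi] on an orthonormal family,
so Bessel's inequality gives [F xi <= V] ([sum_power_le_V]).  The gradients of
the [phi_j] are orthogonal with squared norms [lambda_j], and
[<grad phi_j, grad e_xi> = |xi|^2 <phi_j, e_xi>]; Bessel's inequality for this
second family gives [|xi|^2 F xi <= V L] ([sum_power_le_lambda]).  Hence
[F xi <= V min(1, L / |xi|^2)], which is the gain over the bound [F <= V] alone.

By Plancherel, for every [Y >= L],
[k (Y - L) <= sum_j (Y |phi_j|^2 - |grad phi_j|^2)]
[<= (2 pi)^-2 int (Y - |xi|^2)_+ F xi d xi]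
[<= V / (4 pi) int_0^Y (Y - t) min(1, L / t) dt],
which is [eigenvalue_weight_le].  With [Y = y L] and [y - log y = 3/2] the last
integral is [L^2 K (y - 1)] where [K = y - 1/2], so [k <= V L K / (4 pi)].

Plancherel's formula is replaced by Fourier series on a large square torus, for
test functions that approximate the [phi_j].  Fejer's means of a continuous
function [f] converge uniformly, so [int f^2] is the limit of normalised sums of
[|hat f|^2] over a lattice of step [w], with weights between 0 and 1
([fejer_mean_cvg]).  Applied to a test function and to its partial derivatives,
whose transforms differ by the factors [xi_i], this yields the inequality
[test_function_spectral]; the completeness of the exponentials is not needed.

The sum over the lattice is then compared with the integral by counting lattice
points in discs ([count_disc_le], from the area of a quarter of a disc) and by
summation by parts ([lattice_sum_le]); the one-dimensional sum that is left is
bounded by an explicit antiderivative ([weight_sum_le]).  Letting the step [w]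
and the approximation error tend to 0 gives the result.

The digits of the constant come from the strict monotonicity of [y - log y] and
from partial sums of the exponential series. *)

(** * Integration over squares of the plane *)

Section PlaneMeasure.
Context {R : realType}.
Implicit Types (D Omega : set (R * R)) (f g : R * R -> R).

Let mR2 : measurableType _ := (measurableTypeR R * measurableTypeR R)%type.

(** An open set of the plane is a countable union of squares with rational
centres and sides, hence measurable for the product of the Borel algebras. *)
Lemma open_measurable2 (A : set (R * R)) : open A -> @measurable _ mR2 A.
Proof.
move=> oA.
pose B (q : rat * rat * rat) : set (R * R) :=
  ball (ratr q.1.1 : R) (ratr q.2) `*` ball (ratr q.1.2 : R) (ratr q.2).
have -> : A = \bigcup_(q in [set q | B q `<=` A]) B q.
  apply/seteqP; split=> [[a b] Aab|x [q /= BA /BA//]].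
  have [e /= e0 eA] : exists2 e : R, 0 < e & ball (a, b) e `<=` A.
    by apply/nbhs_ballP; exact: open_nbhs_nbhs.
  have [r /[!in_itv]/= /andP[r0 re]] : exists r, ratr r \in `]0, (e / 2)[%R.
    by apply: rat_in_itvoo; rewrite divr_gt0.
  have near_rat (c : R) : exists q, `|c - ratr q| < ratr r :> R.
    have [q] : exists q, ratr q \in `]c - ratr r, c + ratr r[%R.
      by apply: rat_in_itvoo; rewrite ltrBlDr -addrA ltrDl addr_gt0.
    rewrite in_itv/= => /andP[q1 q2]; exists q.
    by rewrite ltr_distlC q1 q2.
  have [p hp] := near_rat a; have [q hq] := near_rat b.
  exists (p, q, r); last by rewrite /B; split => /=; rewrite -ball_normE/= distrC.
  move=> [u v] /=; rewrite /B -!ball_normE => -[/= hu hv].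
  apply: eA; split => /=; rewrite -ball_normE /=.
    have : `|a - u| <= `|a - ratr p| + `|ratr p - u|.
      by rewrite (_ : a - u = (a - ratr p) + (ratr p - u)) ?ler_normD// addrA subrK.
    lra.
  have : `|b - v| <= `|b - ratr q| + `|ratr q - v|.
    by rewrite (_ : b - v = (b - ratr q) + (ratr q - v)) ?ler_normD// addrA subrK.
  lra.
rewrite bigcup_mkcond; apply: countable_bigcupT_measurable => // q.
case: ifPn => // _.
by apply: measurableX; apply: open_measurable; exact: ball_open.
Qed.

Lemma continuous_measurable2 D f :
  continuous f -> @measurable_fun _ _ mR2 R D f.
Proof.
move=> cf; apply: measurable_funTS.
apply: (measurability _ (RGenOpens.measurableE R)).
move=> _ [_ [a [b ->] <-]]; rewrite setTI.
apply: open_measurable2; apply: open_comp; last exact: interval_open.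
by move=> x _; exact: cf.
Qed.

(** The closed square with both coordinates in [[a, b]]. *)
Definition box (a b : R) : set (R * R) := `[a, b] `*` `[a, b].

Lemma measurable_box a b : @measurable _ mR2 (box a b).
Proof. by apply: measurableX; exact: measurable_itv. Qed.

Lemma leb2_box a b : a < b -> leb2 (box a b) = ((b - a) ^+ 2)%:E.
Proof.
move=> ab; rewrite /leb2 /box product_measure1E; [|exact: measurable_itv..].
by rewrite /= lebesgue_measure_itv/= lte_fin ab -EFinB -EFinM expr2.
Qed.

Lemma compact_box a b : compact (box a b).
Proof. by apply: compact_setX; exact: segment_compact. Qed.

Lemma box_bounded a b f : continuous f -> [bounded f x | x in box a b].
Proof.
move=> cf.
have /compact_bounded[M [Mr HM]] : compact (f @` box a b).
  apply: continuous_compact; last exact: compact_box.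
  exact: continuous_subspaceT.
exists M; split=> // x Mx y Qy; exact: HM.
Qed.

Lemma box_integrable a b f : continuous f ->
  leb2.-integrable (box a b) (EFin \o f).
Proof.
move=> cf; apply: measurable_bounded_integrable.
- exact: measurable_box.
- have [ab|ba] := ltP a b; first by change (leb2 (box a b) < +oo)%E; rewrite leb2_box// ltry.
  apply: (@le_lt_trans _ _ (leb2 (box (b - 1) (a + 1)))).
    apply: le_measure; rewrite ?inE; [exact: measurable_box..|].
    move=> [x y] []; rewrite /= !in_itv /= => /andP[? ?] /andP[? ?].
    by split; rewrite /= in_itv /=; apply/andP; split; lra.
  by change (leb2 (box (b - 1) (a + 1)) < +oo)%E; rewrite leb2_box ?ltry//; lra.
- exact: continuous_measurable2.
- exact: box_bounded.
Qed.

Lemma integral_box1 a b f : continuous f ->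
  (\int[leb2]_(x in box a b) (f x)%:E =
   \int[lebesgue_measure]_(x in `[a, b])
     \int[lebesgue_measure]_(y in `[a, b]) (f (x, y))%:E)%E.
Proof.
move=> cf; rewrite integral_mkcond.
rewrite -(@integral12_prod_meas1 _ _ _ _ _ lebesgue_measure lebesgue_measure).
- rewrite [RHS]integral_mkcond; apply: eq_integral => x _.
  rewrite /fubini_F patchE; case: ifPn => xab.
    rewrite [RHS]integral_mkcond; apply: eq_integral => y _.
    by rewrite !patchE /box in_setX /= xab /=.
  apply: integral0_eq => y _; rewrite patchE /box in_setX /=.
  by rewrite (negbTE xab).
- apply/(integrable_mkcond _ (measurable_box a b)).
  exact: box_integrable.
Qed.

Lemma integral_box2 a b f : continuous f ->
  (\int[leb2]_(x in box a b) (f x)%:E =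
   \int[lebesgue_measure]_(y in `[a, b])
     \int[lebesgue_measure]_(x in `[a, b]) (f (x, y))%:E)%E.
Proof.
move=> cf; rewrite integral_mkcond.
rewrite -(@integral21_prod_meas1 _ _ _ _ _ lebesgue_measure lebesgue_measure).
- rewrite [RHS]integral_mkcond; apply: eq_integral => x _.
  rewrite /fubini_G patchE; case: ifPn => xab.
    rewrite [RHS]integral_mkcond; apply: eq_integral => y _.
    by rewrite !patchE /box in_setX /= xab /= andbT.
  apply: integral0_eq => y _; rewrite patchE /box in_setX /=.
  by rewrite (negbTE xab) andbF.
- apply/(integrable_mkcond _ (measurable_box a b)).
  exact: box_integrable.
Qed.

(** The partial derivatives are the derivatives of the partial functions; the
next six lemmas make this precise for both coordinates. *)
Lemma partial_slope0 f a b (h : R) :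
  ((f \o shift (a, b)) (h *: basis_vec ord0) - f (a, b)) =
  (((fun t => f (t, b)) \o shift a) (h *: 1) - f (a, b)).
Proof.
by rewrite /basis_vec /shift /=; congr (f (_, _) - _); rewrite /= scaler0 add0r.
Qed.

Lemma partial_slope1 f a b (h : R) :
  ((f \o shift (a, b)) (h *: basis_vec ord_max) - f (a, b)) =
  (((fun t => f (a, t)) \o shift b) (h *: 1) - f (a, b)).
Proof.
by rewrite /basis_vec /shift /=; congr (f (_, _) - _); rewrite /= scaler0 add0r.
Qed.

Lemma derivable_partial0 f a b :
  derivable f (a, b) (basis_vec ord0) <-> derivable (fun t => f (t, b)) a 1.
Proof.
rewrite /derivable; split=> [|] /=.
  by under eq_fun do rewrite partial_slope0.
by under [in X in _ -> X]eq_fun do rewrite partial_slope0.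
Qed.

Lemma derivable_partial1 f a b :
  derivable f (a, b) (basis_vec ord_max) <-> derivable (fun t => f (a, t)) b 1.
Proof.
rewrite /derivable; split=> [|] /=.
  by under eq_fun do rewrite partial_slope1.
by under [in X in _ -> X]eq_fun do rewrite partial_slope1.
Qed.

Lemma partial0E f a b : partial ord0 f (a, b) = derive1 (fun t => f (t, b)) a.
Proof.
rewrite derive1E /partial /derive.
by under eq_fun do rewrite partial_slope0.
Qed.

Lemma partial1E f a b : partial ord_max f (a, b) = derive1 (fun t => f (a, t)) b.
Proof.
rewrite derive1E /partial /derive.
by under eq_fun do rewrite partial_slope1.
Qed.

Lemma continuous_pairl (y : R) : continuous (fun t : R => (t, y)).
Proof.
move=> x; apply: (@cvg_pair _ _ _ (nbhs x) (nbhs x) (nbhs y)).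
  exact: cvg_id.
exact: cvg_cst.
Qed.

Lemma continuous_pairr (x : R) : continuous (fun t : R => (x, t)).
Proof.
move=> y; apply: (@cvg_pair _ _ _ (nbhs y) (nbhs x) (nbhs y)).
  exact: cvg_cst.
exact: cvg_id.
Qed.

Lemma integral_derive1_eq0 (F : R -> R) a b : a < b ->
  (forall x, derivable F x 1) -> continuous (derive1 F) -> F a = F b ->
  (\int[lebesgue_measure]_(x in `[a, b]) (derive1 F x)%:E = 0)%E.
Proof.
move=> ab dF cF Fab.
have cF0 : continuous F.
  by move=> x; apply: differentiable_continuous; exact/derivable1_diffP.
transitivity ((F b)%:E - (F a)%:E)%E; last by rewrite Fab -EFinB subrr.
apply: continuous_FTC2; [exact: ab| | |by []].
- exact: continuous_subspaceT.
- split=> [x _||]; [exact: dF|apply: cvg_at_right_filter; exact: cF0|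
    apply: cvg_at_left_filter; exact: cF0].
Qed.

(** The integral of a partial derivative over a square vanishes when the function
takes the same values on the two opposite sides: this covers both periodic
functions and functions vanishing near the boundary. *)
Lemma integral_box_partial0 f a b : a < b -> continuous f ->
  (forall x, derivable f x (basis_vec ord0)) ->
  continuous (partial ord0 f) ->
  (forall y, a <= y <= b -> f (a, y) = f (b, y)) ->
  \int[leb2]_(x in box a b) partial ord0 f x = 0.
Proof.
move=> ab cf df cdf fab; rewrite /Rintegral integral_box2//.
rewrite integral0_eq// => y /= /[!in_itv] /= yab.
under eq_integral do rewrite partial0E.
apply: integral_derive1_eq0 => //.
- by move=> x; apply/derivable_partial0; exact: df.
- have -> : derive1 (fun t => f (t, y)) = partial ord0 f \o (fun t => (t, y)).
    by apply/funext => x; rewrite -partial0E.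
  move=> x; apply: continuous_comp; last exact: cdf.
  exact: continuous_pairl.
- exact: fab.
Qed.

Lemma integral_box_partial1 f a b : a < b -> continuous f ->
  (forall x, derivable f x (basis_vec ord_max)) ->
  continuous (partial ord_max f) ->
  (forall x, a <= x <= b -> f (x, a) = f (x, b)) ->
  \int[leb2]_(x in box a b) partial ord_max f x = 0.
Proof.
move=> ab cf df cdf fab; rewrite /Rintegral integral_box1//.
rewrite integral0_eq// => x /= /[!in_itv] /= xab.
under eq_integral do rewrite partial1E.
apply: integral_derive1_eq0 => //.
- by move=> y; apply/derivable_partial1; exact: df.
- have -> : derive1 (fun t => f (x, t)) = partial ord_max f \o (fun t => (x, t)).
    by apply/funext => y; rewrite -partial1E.
  move=> y; apply: continuous_comp; last exact: cdf.
  exact: continuous_pairr.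
- exact: fab.
Qed.

End PlaneMeasure.

(** * Plane waves and integration by parts *)

Section Waves.
Context {R : realType}.
Implicit Types (x xi : R * R) (f g : R * R -> R) (a : R).

(** The [i]-th coordinate of a point of the plane. *)
Definition xcoord (i : 'I_2) x : R := if i == 0 then x.1 else x.2.

(** The real plane wave of frequency [xi] and phase [a].  A derivative shifts the
phase by [pi / 2], and the phases 0 and [pi / 2] give the cosine and, up to sign,
the sine. *)
Definition wave xi a : R * R -> R :=
  fun x => cos (xi.1 * x.1 + xi.2 * x.2 + a).

Lemma ord2P (P : 'I_2 -> Prop) : P ord0 -> P ord_max -> forall i, P i.
Proof.
move=> P0 P1 [[|[|]] //= i2].
- by rewrite (_ : Ordinal i2 = ord0)//; exact: val_inj.
- by rewrite (_ : Ordinal i2 = ord_max)//; exact: val_inj.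
Qed.

Lemma continuous_wave xi a : continuous (wave xi a).
Proof.
move=> x; rewrite /wave.
apply: (@continuous_comp _ _ _ (fun x : R * R => xi.1 * x.1 + xi.2 * x.2 + a) cos);
  last exact: continuous_cos.
apply: cvgD; last exact: cvg_cst.
by apply: cvgD; apply: cvgM; try exact: cvg_cst; [exact: cvg_fst|exact: cvg_snd].
Qed.

Lemma wave_le1 xi a x : `|wave xi a x| <= 1.
Proof. exact: cos_max. Qed.

Lemma is_derive_wave i xi a x :
  is_derive x (basis_vec i) (wave xi a) (xcoord i xi * wave xi (a + pi / 2) x).
Proof.
have lin (k c s : R) :
    is_derive s 1 (fun t => cos (k * t + c)) (k * cos (k * s + c + pi / 2)).
  have d1 : is_derive s 1 (fun t => k * t + c) k.
    by apply: is_derive_eq; rewrite addr0 scaler1.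
  have := @is_derive1_comp _ cos _ s _ _ (is_derive_cos _) d1.
  by rewrite mulrC cosDpihalf.
case: x => u v; move: i; apply: ord2P.
- have [D e] : is_derive u 1
      (fun t => wave xi a (t, v)) (xi.1 * wave xi (a + pi / 2) (u, v)).
    have -> : (fun t => wave xi a (t, v)) =
              (fun t => cos (xi.1 * t + (xi.2 * v + a))).
      by apply/funext => t; rewrite /wave /= addrA.
    by rewrite /wave /= (_ : _ + (a + _) = xi.1 * u + (xi.2 * v + a) + pi / 2);
      [exact: lin|rewrite !addrA].
  split; first exact/derivable_partial0.
  by rewrite -[LHS]/(partial _ _ _) partial0E derive1E e.
- have [D e] : is_derive v 1
      (fun t => wave xi a (u, t)) (xi.2 * wave xi (a + pi / 2) (u, v)).
    have E t c : wave xi c (u, t) = cos (xi.2 * t + (xi.1 * u + c)).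
      by rewrite /wave /= addrA [xi.2 * t + _]addrC.
    have -> : (fun t => wave xi a (u, t)) =
              (fun t => cos (xi.2 * t + (xi.1 * u + a))).
      by apply/funext => t; exact: E.
    by rewrite E (_ : _ + (_ + _) = xi.2 * v + (xi.1 * u + a) + pi / 2);
      [exact: lin|rewrite !addrA].
  split; first exact/derivable_partial1.
  by rewrite -[LHS]/(partial _ _ _) partial1E derive1E e.
Qed.

Lemma partial_wave i xi a :
  partial i (wave xi a) = (fun x => xcoord i xi * wave xi (a + pi / 2) x).
Proof. by apply/funext => x; have [_ ] := is_derive_wave i xi a x. Qed.

Lemma derivable_wave i xi a x : derivable (wave xi a) x (basis_vec i).
Proof. by have [] := is_derive_wave i xi a x. Qed.

Lemma waveDpi xi a x : wave xi (a + pi) x = - wave xi a x.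
Proof. by rewrite /wave addrA cosDpi. Qed.

Lemma wave_sqr xi a x : wave xi a x ^+ 2 + wave xi (a + pi / 2) x ^+ 2 = 1.
Proof. by rewrite /wave addrA cosDpihalf sqrrN cos2Dsin2. Qed.

Lemma cosD2pi_int (m : int) (t : R) : cos (t + m%:~R * (2 * pi)) = cos t.
Proof.
have E n (s : R) : cos (s + n%:R * (2 * pi)) = cos s.
  have := periodicn (@cosD2pi R) n s.
  by rewrite -[_ *+ n]mulr_natl -[pi *+ 2]mulr_natl.
case: m => n; first by rewrite -pmulrn E.
by rewrite NegzE mulrNz -pmulrn -{2}(subrK (n.+1%:R * (2 * pi)) t) E mulNr.
Qed.

(** The frequency of index [n] in the lattice of step [w]; the corresponding waves
have period [2 * pi / w] in each coordinate. *)
Definition freq (w : R) (n : int * int) : R * R := (w * n.1%:~R, w * n.2%:~R).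

Lemma integral_box_wave (w a : R) (n : int * int) : 0 < w ->
  \int[leb2]_(x in box (- (pi / w)) (pi / w)) wave (freq w n) a x =
  if n == 0 then cos a * (2 * pi / w) ^+ 2 else 0.
Proof.
move=> w0; have l0 : - (pi / w) < pi / w :> R.
  by rewrite gtrN// divr_gt0// pi_gt0.
have cL f k : continuous f -> continuous (fun x : R * R => k * f x).
  by move=> cf x; apply: cvgM; [exact: cvg_cst|exact: cf].
have step i : xcoord i (freq w n) != 0 ->
    wave (freq w n) a =
      partial i (fun x => (xcoord i (freq w n))^-1 * wave (freq w n) (a - pi / 2) x).
  move=> k0; apply/funext => x; rewrite /partial.
  rewrite [RHS](@deriveMl _ _ (wave (freq w n) (a - pi / 2)))//; last first.
    exact: derivable_wave.
  by rewrite -[X in _ * X]/(partial _ _ _) partial_wave mulKf// subrK.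
have stepd i k b x : derivable (fun x => k * wave (freq w n) b x) x (basis_vec i).
  apply: (@derivableM _ _ (cst k)); first exact: derivable_cst.
  exact: derivable_wave.
have per (k : R) (m : int) : k = w * m%:~R ->
    k * (pi / w) = - (k * (pi / w)) + m%:~R * (2 * pi).
  by move=> ->; field; rewrite gt_eqF.
have [n0|n0] := eqVneq n.1 0; first have [n1|n1] := eqVneq n.2 0.
(* For [n = 0] the wave is constant; otherwise it is a partial derivative, along a
   coordinate where [n] does not vanish, of a periodic wave. *)
- case: n n0 n1 {step stepd} => _ _ /= -> ->; rewrite eqxx.
  rewrite (_ : wave _ _ = cst (cos a)); last first.
    by apply/funext => x; rewrite /wave /freq /= !mulr0 !mul0r !add0r.
  rewrite Rintegral_cst; last exact: measurable_box.
  rewrite [X in fine X](leb2_box l0) /= opprK; congr (_ * _ ^+ 2); by field; rewrite gt_eqF.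
- rewrite ifF; last by apply: contra_neqF n1 => /eqP ->.
  have k0 : xcoord ord_max (freq w n) != 0.
    by rewrite /xcoord /=; apply: mulf_neq0; [rewrite gt_eqF|rewrite intr_eq0].
  rewrite (step _ k0); apply: integral_box_partial1 => //.
  - exact/cL/continuous_wave.
  - by rewrite -step//; exact: continuous_wave.
  - move=> x _; congr (_ * _); rewrite /wave /= mulrN.
    rewrite -[LHS](cosD2pi_int n.2) [in RHS](per (w * n.2%:~R) n.2 erefl).
    by congr cos; ring.
- rewrite ifF; last by apply: contra_neqF n0 => /eqP ->.
  have k0 : xcoord ord0 (freq w n) != 0.
    by rewrite /xcoord /=; apply: mulf_neq0; [rewrite gt_eqF|rewrite intr_eq0].
  rewrite (step _ k0); apply: integral_box_partial0 => //.
  - exact/cL/continuous_wave.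
  - by rewrite -step//; exact: continuous_wave.
  - move=> x _; congr (_ * _); rewrite /wave /= mulrN.
    rewrite -[LHS](cosD2pi_int n.1) [in RHS](per (w * n.1%:~R) n.1 erefl).
    by congr cos; ring.
Qed.

Lemma test_function_C1 (Omega : set (R * R)) psi i : test_function Omega psi ->
  [/\ continuous psi, forall x, derivable psi x (basis_vec i) &
      continuous (partial i psi)].
Proof. by case=> /(_ 1) [c1 /(_ i)[d1 [c2 _]]]. Qed.

(** The closed support of a test function lies in [Omega], so the function
vanishes near every point outside [Omega], and its derivatives vanish there. *)
Lemma test_function_eq0 (Omega : set (R * R)) psi x : test_function Omega psi ->
  ~ Omega x -> psi x = 0 /\ forall i, partial i psi x = 0.
Proof.
case=> _ _ sO Ox; have Sx : ~ closure [set x | psi x != 0] x by move=> /sO.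
have n0 : \near x, psi x = 0.
  have : nbhs x (~` closure [set x | psi x != 0]).
    by apply: open_nbhs_nbhs; split => //; apply: closed_openC; exact: closed_closure.
  apply: filterS => y Sy; apply/eqP; apply: contrapT => /negP py.
  by apply: Sy; apply: subset_closure.
split; first exact: nbhs_singleton n0.
by move=> i; rewrite /partial (near_eq_derive _ n0) (derive_cst (0 : R)).
Qed.

Lemma test_function_bounded_support (Omega : set (R * R)) psi :
  test_function Omega psi -> exists2 r : R, 0 < r &
  forall x, r <= `|x| -> psi x = 0 /\ forall i, partial i psi x = 0.
Proof.
move=> tpsi; case: (tpsi) => C cS _.
have [M [Mr HM]] := compact_bounded cS.
exists (`|M| + 2); first by rewrite ltr_wpDl.
move=> x xM; apply: (@test_function_eq0 (closure [set x | psi x != 0])); first by split.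
move=> /(HM (`|M| + 1)); rewrite ltr_pwDr ?ler_norm// => /(_ isT).
move=> xM'; by have := le_trans xM xM'; lra.
Qed.

(** Integration by parts against a wave; there is no boundary term because [f]
vanishes on the boundary of the square. *)
Lemma integral_box_partial_wave i f xi a (l : R) : 0 < l ->
  continuous f -> (forall x, derivable f x (basis_vec i)) ->
  continuous (partial i f) -> (forall x, l <= `|x| -> f x = 0) ->
  \int[leb2]_(x in box (- l) l) (partial i f x * wave xi a x) =
  - xcoord i xi * \int[leb2]_(x in box (- l) l) (f x * wave xi (a + pi / 2) x).
Proof.
move=> l0 cf df cdf f0; have l2 : - l < l by rewrite gtrN.
have cM g h : continuous g -> continuous h -> continuous (g \* h : R * R -> R).
  by move=> cg ch x; apply: cvgM; [exact: cg|exact: ch].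
have cZ k g : continuous g -> continuous (fun x => k * g x : R).
  by move=> cg x; apply: cvgM; [exact: cvg_cst|exact: cg].
pose F := f \* wave xi a.
have dF x : derivable F x (basis_vec i) by apply: derivableM; [|exact: derivable_wave].
have pF : partial i F = (fun x => partial i f x * wave xi a x +
                        xcoord i xi * (f x * wave xi (a + pi / 2) x)).
  apply/funext => x; rewrite {1}/partial deriveM//; last exact: derivable_wave.
  rewrite -[X in f x *: X]/(partial _ _ _) partial_wave -[X in _ + _ *: X]/(partial _ _ _).
  by rewrite addrC /GRing.scale /=; ring.
have cpF : continuous (partial i F).
  rewrite pF => x; apply: cvgD; first exact/cM/continuous_wave.
  exact/cZ/cM/continuous_wave.
have bd (y : R) : `|(l, y)| >= l /\ `|(-l, y)| >= l /\ `|(y, l)| >= l /\ `|(y, -l)| >= l.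
  by rewrite !prod_normE /= !le_max !normrN (ger0_norm (ltW l0)) lexx !orbT.
have : \int[leb2]_(x in box (- l) l) partial i F x = 0.
  have cF : continuous F by exact/cM/continuous_wave.
  have F0 x : l <= `|x| -> F x = 0 by rewrite /F /= => /f0 ->; rewrite mul0r.
  move: i df cdf dF cpF {pF} => i; move: i; apply: ord2P => df cdf dF cpF.
    by apply: integral_box_partial0 => // y _; have [? [? _]] := bd y; rewrite !F0.
  by apply: integral_box_partial1 => // y _; have [_ [_ [? ?]]] := bd y; rewrite !F0.
rewrite pF RintegralD; last 3 first.
- exact: measurable_box.
- exact/box_integrable/cM/continuous_wave.
- exact/box_integrable/cZ/cM/continuous_wave.
rewrite RintegralZl; last 2 first.
- exact: measurable_box.
- exact/box_integrable/cM/continuous_wave.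
by move=> /eqP; rewrite addr_eq0 => /eqP ->; rewrite mulNr.
Qed.

End Waves.

(** * Calculus of integrals of continuous functions over a square *)

Section BoxCalculus.
Context {R : realType}.
Implicit Types (f g : R * R -> R).

Lemma continuousM2 (T : topologicalType) (f g : T -> R) :
  continuous f -> continuous g -> continuous (fun x => f x * g x).
Proof. by move=> cf cg x; apply: cvgM; [exact: cf|exact: cg]. Qed.

Lemma continuousD2 (T : topologicalType) (f g : T -> R) :
  continuous f -> continuous g -> continuous (fun x => f x + g x).
Proof. by move=> cf cg x; apply: cvgD; [exact: cf|exact: cg]. Qed.

Lemma continuousB2 (T : topologicalType) (f g : T -> R) :
  continuous f -> continuous g -> continuous (fun x => f x - g x).
Proof. by move=> cf cg x; apply: cvgB; [exact: cf|exact: cg]. Qed.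

Lemma continuous_cst2 (T : topologicalType) (k : R) :
  continuous (fun _ : T => k).
Proof. by move=> x; exact: cvg_cst. Qed.

Lemma continuous_sum2 (T : topologicalType) (I : Type) (s : seq I)
    (F : I -> T -> R) :
  (forall i, continuous (F i)) -> continuous (fun x => \sum_(i <- s) F i x).
Proof.
move=> cF; elim: s => [|i s ih].
  by under eq_fun do rewrite big_nil; exact: continuous_cst2.
by under eq_fun do rewrite big_cons; exact: continuousD2.
Qed.

Variables (a b : R).
Local Notation Q := (box a b).

Lemma box_RintegralD f g : continuous f -> continuous g ->
  \int[leb2]_(x in Q) (f x + g x) =
  \int[leb2]_(x in Q) f x + \int[leb2]_(x in Q) g x.
Proof.
by move=> cf cg; apply: RintegralD;
  [exact: measurable_box|exact: box_integrable|exact: box_integrable].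
Qed.

Lemma box_RintegralB f g : continuous f -> continuous g ->
  \int[leb2]_(x in Q) (f x - g x) =
  \int[leb2]_(x in Q) f x - \int[leb2]_(x in Q) g x.
Proof.
by move=> cf cg; apply: RintegralB;
  [exact: measurable_box|exact: box_integrable|exact: box_integrable].
Qed.

Lemma box_RintegralZl (k : R) f : continuous f ->
  \int[leb2]_(x in Q) (k * f x) = k * \int[leb2]_(x in Q) f x.
Proof.
by move=> cf; apply: RintegralZl; [exact: measurable_box|exact: box_integrable].
Qed.

Lemma box_Rintegral_sum (I : Type) (s : seq I) (F : I -> R * R -> R) :
  (forall i, continuous (F i)) ->
  \int[leb2]_(x in Q) (\sum_(i <- s) F i x) =
  \sum_(i <- s) \int[leb2]_(x in Q) F i x.
Proof.
move=> cF; elim: s => [|i s ih].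
  rewrite big_nil; under eq_Rintegral do rewrite big_nil.
  by rewrite Rintegral_cst ?mul0r//; exact: measurable_box.
rewrite big_cons -ih -box_RintegralD//; last exact: continuous_sum2.
by apply: eq_Rintegral => x _; rewrite big_cons.
Qed.

Lemma box_le_Rintegral f g : continuous f -> continuous g ->
  (forall x, Q x -> f x <= g x) ->
  \int[leb2]_(x in Q) f x <= \int[leb2]_(x in Q) g x.
Proof.
by move=> cf cg fg; apply: le_Rintegral;
  [exact: measurable_box|exact: box_integrable|exact: box_integrable|].
Qed.

Lemma box_normr_Rintegral f : continuous f ->
  `|\int[leb2]_(x in Q) f x| <= \int[leb2]_(x in Q) `|f x|.
Proof.
by move=> cf; apply: le_normr_Rintegral;
  [exact: measurable_box|exact: box_integrable].
Qed.

End BoxCalculus.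

(** * Fejer means on a large torus *)

Section Modulus.
Context {R : realType}.

(** On a compact set, a function that is at most 0 wherever [D >= 0] vanishes is
at most any [e > 0] up to a multiple of [D].  This plays the role of a modulus
of continuity. *)
Lemma compact_dominated (T : topologicalType) (K : set T) (g D : T -> R) (e : R) :
  compact K -> continuous g -> continuous D -> 0 < e ->
  (forall z, K z -> 0 <= D z) -> (forall z, K z -> D z = 0 -> g z <= 0) ->
  exists2 C : R, 0 <= C & forall z, K z -> g z <= e + C * D z.
Proof.
move=> cK cg cD e0 D0 gD0.
have : \forall C \near +oo, K `<=` (fun z => 0 <= C /\ g z <= e + C * D z).
  move/compact_near_coveringP/near_covering_withinP : cK; apply => x Kx.
  have [ge|ge] := ltP (g x) e.
    have nx : \forall x' \near x, g x' < e by exact: (cg x _ (lt_nbhsl ge)).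
    exists ([set x' | g x' < e], [set C | 0 <= C]).
      by split; [exact: nx|exact: nbhs_pinfty_ge].
    move=> [x' C] [/= gx C0] Kx'; split => //; apply: (le_trans (ltW gx)).
    by rewrite lerDl mulr_ge0// D0.
  have Dx : 0 < D x.
    rewrite lt_neqAle D0// andbT eq_sym; apply/eqP => /(gD0 _ Kx).
    by move=> /(le_trans ge); rewrite leNgt e0.
  pose C0 := (g x + 1) / (D x / 2).
  have C00 : 0 <= C0.
    by rewrite divr_ge0 ?addr_ge0 ?divr_ge0//; [exact: le_trans (ltW e0) ge|exact: ltW].
  exists ([set x' | g x' < g x + 1 /\ D x / 2 < D x'], [set C | C0 <= C]).
    split; last by apply: nbhs_pinfty_ge; exact: num_real.
    have gx1 : g x < g x + 1 by rewrite ltrDl.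
    have Dx2 : D x / 2 < D x by rewrite ltr_pdivrMr// mulr_natr mulr2n ltrDl.
    by apply: filterI; [exact: (cg x _ (lt_nbhsl gx1))|exact: (cD x _ (lt_nbhsr Dx2))].
  move=> [x' C] [/= [gx Dx'] C0C] Kx'; have Cge := le_trans C00 C0C; split => //.
  apply: (le_trans (ltW gx)); apply: (@le_trans _ _ (C * D x')); last first.
    by rewrite lerDr ltW.
  apply: (@le_trans _ _ (C * (D x / 2))).
    by rewrite -ler_pdivrMr// divr_gt0.
  by rewrite ler_wpM2l// ltW.
case=> M [Mr HM]; have := HM (`|M| + 1); rewrite ltr_pwDr ?ler_norm// => /(_ isT) H.
by exists (`|M| + 1); [rewrite addr_ge0|move=> z /H[]].
Qed.

End Modulus.

Section Fejer.
Context {R : realType}.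
Implicit Types (f g : R * R -> R) (x y xi : R * R) (n m : int * int).

(** The scalar product of the plane. *)
Definition dot xi x : R := xi.1 * x.1 + xi.2 * x.2.

(** The squared modulus at [xi] of the Fourier transform of [f] restricted to
[D], that is the squared integrals of [f] against [cos (xi . x)] and
[sin (xi . x)]. *)
Definition power (D : set (R * R)) f xi : R :=
  (\int[leb2]_(x in D) (f x * wave xi 0 x)) ^+ 2 +
  (\int[leb2]_(x in D) (f x * wave xi (pi / 2) x)) ^+ 2.

Lemma power_ge0 D f xi : 0 <= power D f xi.
Proof. by rewrite addr_ge0// sqr_ge0. Qed.

(** Both sides are [cos (xi . (x - y))]. *)
Lemma wave_diff xi x y : wave xi (- dot xi x) y =
  wave xi 0 x * wave xi 0 y + wave xi (pi / 2) x * wave xi (pi / 2) y.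
Proof. by rewrite /wave !addr0 !cosDpihalf mulrNN -/(dot xi x) -/(dot xi y) -cosB -cosN opprB addrC. Qed.

(* The torus is represented by the square [Q] of side [2 * pi / w]. *)
Variables (w : R) (w0 : 0 < w).
Local Notation l := (pi / w).
Local Notation Q := (box (- l) l).
Local Notation area := ((2 * pi / w) ^+ 2).

Lemma freqD n m : freq w (n + m) = freq w n + freq w m.
Proof. by rewrite /freq /= !intrD !mulrDr. Qed.

Lemma freqN n : freq w (- n) = - freq w n.
Proof. by rewrite /freq /= !mulrNz !mulrN. Qed.

Lemma waveM n m (a b : R) x : wave (freq w n) a x * wave (freq w m) b x =
  2^-1 * (wave (freq w (n + m)) (a + b) x + wave (freq w (n - m)) (a - b) x).
Proof.
rewrite !freqD freqN /wave /= !mulrDl !mulNr.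
set u := _ * x.1; set v := _ * x.2; set u' := _ * x.1; set v' := _ * x.2.
rewrite (_ : u + u' + (v + v') + (a + b) = (u + v + a) + (u' + v' + b)); last by ring.
rewrite (_ : u - u' + (v - v') + (a - b) = (u + v + a) - (u' + v' + b)); last by ring.
by move: (u + v + a) (u' + v' + b) => X Y; rewrite cosD cosB; field.
Qed.

Lemma integral_box_waveM n m (a b : R) :
  \int[leb2]_(x in Q) (wave (freq w n) a x * wave (freq w m) b x) =
  area / 2 * ((n + m == 0)%:R * cos (a + b) + (n - m == 0)%:R * cos (a - b)).
Proof.
under eq_Rintegral do rewrite waveM.
rewrite box_RintegralZl; last by apply: continuousD2; exact: continuous_wave.
rewrite box_RintegralD; [|exact: continuous_wave..].
rewrite !integral_box_wave//.
by case: eqP => _; case: eqP => _ /=; field; rewrite gt_eqF.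
Qed.

Variables (N : nat) (N0 : (0 < N)%N).
Local Notation T := ('I_N * 'I_N)%type.

(** The difference of two pairs of indices, as a frequency index. *)
Definition index_diff (p q : T) : int * int :=
  ((p.1 : nat)%:Z - (q.1 : nat)%:Z, (p.2 : nat)%:Z - (q.2 : nat)%:Z).

(** The two-dimensional Fejer kernel at [x - y]: the average over [q] of the sums
over [p] of the waves of index [p - q], with [p] and [q] in a square of side
[N]. *)
Definition fejer x y : R := (N%:R ^- 2) * \sum_(p : T) \sum_(q : T)
  wave (freq w (index_diff p q)) (- dot (freq w (index_diff p q)) x) y.

Lemma continuous_fejer x : continuous (fejer x).
Proof.
apply: continuousM2; first exact: continuous_cst2.
by apply: continuous_sum2 => p; apply: continuous_sum2 => q; exact: continuous_wave.
Qed.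

(** The double sum of [cos (A p - A q)] is the sum of the squares of the sums of
[cos (A p)] and of [sin (A p)]. *)
Lemma fejer_ge0 x y : 0 <= fejer x y.
Proof.
rewrite /fejer mulr_ge0 ?invr_ge0 ?exprn_ge0//.
pose A (p : T) := w * (p.1 : nat)%:R * (y.1 - x.1) + w * (p.2 : nat)%:R * (y.2 - x.2).
rewrite (_ : \sum_p _ = (\sum_p cos (A p)) ^+ 2 + (\sum_p sin (A p)) ^+ 2).
  by rewrite addr_ge0// sqr_ge0.
rewrite !expr2 !big_distrlr /= -big_split; apply: eq_bigr => p _ /=.
rewrite -big_split; apply: eq_bigr => q _ /=.
rewrite -cosB /wave /dot /freq /index_diff /A /=; congr cos.
by rewrite !intrB -!pmulrn; ring.
Qed.

Lemma sum_index_diff (F G : 'I_N -> 'I_N -> R) :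
  \sum_(p : T) \sum_(q : T) F p.1 q.1 * G p.2 q.2 =
  (\sum_i \sum_j F i j) * (\sum_i \sum_j G i j).
Proof.
rewrite big_distrlr /= [RHS]pair_bigA; apply: eq_bigr => p _ /=.
by rewrite big_distrlr /= [RHS]pair_bigA.
Qed.

Lemma count_diff0 : \sum_(i < N) \sum_(j < N) ((i : nat)%:Z - (j : nat)%:Z == 0)%:R
  = N%:R :> R.
Proof.
under eq_bigr => i _.
  rewrite (bigD1 i)//= subrr eqxx big1 ?addr0; last first.
    move=> j ji; rewrite subr_eq0 eqz_nat; case: eqP => // e.
    by case/eqP: ji; apply: val_inj.
  over.
by rewrite sumr_const card_ord.
Qed.

(** Among the pairs of indices below [N], exactly [N - 1] have difference 1. *)
Lemma count_diff1 : \sum_(i < N) \sum_(j < N) ((i : nat)%:Z - (j : nat)%:Z == 1)%:R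
  = N%:R - 1 :> R.
Proof.
case: N N0 => // M _; rewrite big_ord_recl /= big1 ?add0r; last first.
  by move=> j _; rewrite sub0r; case: (nat_of_ord j).
rewrite (eq_bigr (fun=> 1)) ?sumr_const ?card_ord; first by rewrite -natr1 addrK.
move=> i _; have iM : (i < M.+1)%N by rewrite ltnW// ltnS.
rewrite (bigD1 (Ordinal iM))//= big1 ?addr0; last first.
  move=> j ji; case: eqP => //= e; case/eqP: ji; apply: val_inj => /=.
  by move: e; rewrite /bump /=; lia.
by rewrite (_ : (_ == _) = true)//; apply/eqP; rewrite /bump /=; lia.
Qed.

Lemma dot_freq0 x : dot (freq w 0) x = 0.
Proof. by rewrite /dot /freq /= mulr0 !mul0r addr0. Qed.

Lemma dot_freqD n m x : dot (freq w (n + m)) x = dot (freq w n) x + dot (freq w m) x.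
Proof. by rewrite freqD /dot /= !mulrDl addrACA. Qed.

Lemma dot_freqN n x : dot (freq w (- n)) x = - dot (freq w n) x.
Proof. by rewrite freqN /dot /= !mulNr opprD. Qed.

Lemma integral_fejer x : \int[leb2]_(y in Q) fejer x y = area.
Proof.
rewrite box_RintegralZl; last first.
  by apply: continuous_sum2 => p; apply: continuous_sum2 => q; exact: continuous_wave.
rewrite box_Rintegral_sum; last first.
  by move=> p; apply: continuous_sum2 => q; exact: continuous_wave.
under eq_bigr => p _.
  rewrite box_Rintegral_sum; last by move=> q; exact: continuous_wave.
  under eq_bigr => q _.
    rewrite integral_box_wave//.
    rewrite (_ : (if _ then _ else _) = area * (((p.1 : nat)%:Z - (q.1 : nat)%:Z == 0)%:R *
       ((p.2 : nat)%:Z - (q.2 : nat)%:Z == 0)%:R)); last first.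
      rewrite -natrM mulnb; case: (altP (index_diff p q =P 0)) => [e|].
        by rewrite e dot_freq0 oppr0 cos0 mul1r; case: e => -> ->; rewrite eqxx mulr1.
      by rewrite /index_diff -pair_eqE /pair_eq /= => /negbTE ->; rewrite mulr0.
    over.
  rewrite -big_distrr /=.
  over.
rewrite -big_distrr /= (sum_index_diff (fun i j : 'I_N => ((i : nat)%:Z - (j : nat)%:Z == 0)%:R)
  (fun i j : 'I_N => ((i : nat)%:Z - (j : nat)%:Z == 0)%:R)) count_diff0.
by field; rewrite gt_eqF//= pnatr_eq0 -lt0n.
Qed.

Lemma sum_index_diff_eq (e : int * int) : e = (1, 0) \/ e = (0, 1) ->
  \sum_(p : T) \sum_(q : T) (index_diff p q - e == 0)%:R = N%:R * (N%:R - 1) :> R.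
Proof.
have E (p q : T) (a b : int) : (index_diff p q - (a, b) == 0)%:R =
    ((p.1 : nat)%:Z - (q.1 : nat)%:Z == a)%:R *
    ((p.2 : nat)%:Z - (q.2 : nat)%:Z == b)%:R :> R.
  by rewrite -natrM mulnb subr_eq0 /index_diff -pair_eqE.
case=> ->; under eq_bigr do under eq_bigr do rewrite E.
  rewrite (sum_index_diff (fun i j : 'I_N => ((i : nat)%:Z - (j : nat)%:Z == 1)%:R)
  (fun i j : 'I_N => ((i : nat)%:Z - (j : nat)%:Z == 0)%:R)) count_diff0 count_diff1.
  by rewrite mulrC.
by rewrite (sum_index_diff (fun i j : 'I_N => ((i : nat)%:Z - (j : nat)%:Z == 0)%:R)
  (fun i j : 'I_N => ((i : nat)%:Z - (j : nat)%:Z == 1)%:R)) count_diff0 count_diff1.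
Qed.

(** The defect [1 / N] with respect to [integral_fejer] measures the concentration
of the kernel near the diagonal. *)
Lemma integral_fejer_wave x (e : int * int) : e = (1, 0) \/ e = (0, 1) ->
  \int[leb2]_(y in Q) (fejer x y * wave (freq w e) (- dot (freq w e) x) y) =
  area * (1 - N%:R^-1).
Proof.
move=> e01; under eq_Rintegral do rewrite /fejer -mulrA big_distrl /=.
have cw n a p q b : continuous (fun y => wave (freq w (index_diff p q)) b y * wave (freq w n) a y).
  by apply: continuousM2; exact: continuous_wave.
under eq_Rintegral do under eq_bigr do rewrite big_distrl /=.
rewrite box_RintegralZl; last first.
  by apply: continuous_sum2 => p; apply: continuous_sum2 => q; exact: cw.
rewrite box_Rintegral_sum; last first.
  by move=> p; apply: continuous_sum2 => q; exact: cw.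
under eq_bigr => p _.
  rewrite box_Rintegral_sum; last by move=> q; exact: cw.
  under eq_bigr => q _.
    rewrite integral_box_waveM.
    have -> : (index_diff p q + e == 0)%:R * cos (- dot (freq w (index_diff p q)) x
        + - dot (freq w e) x) = (index_diff q p - e == 0)%:R.
      have -> : index_diff q p - e = - (index_diff p q + e).
        by rewrite opprD; congr (_ - _); rewrite /index_diff; congr pair => /=; rewrite opprB.
      rewrite oppr_eq0; case: eqP => [h|]; rewrite ?mul0r//.
      by rewrite -opprD -dot_freqD h dot_freq0 oppr0 cos0 mulr1.
    have -> : (index_diff p q - e == 0)%:R * cos (- dot (freq w (index_diff p q)) x
        - - dot (freq w e) x) = (index_diff p q - e == 0)%:R.
      case: eqP => [h|]; rewrite ?mul0r//.
      by rewrite -opprD -dot_freqN -dot_freqD h dot_freq0 oppr0 cos0 mulr1.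
    over.
  rewrite -big_distrr /= big_split /=.
  over.
rewrite -big_distrr /= big_split /= [X in _ * (_ * (X + _))]exchange_big /=.
rewrite !sum_index_diff_eq//.
by field; rewrite pnatr_eq0 -lt0n N0 gt_eqF.
Qed.

(** [(1 - cos (w (y1 - x1))) + (1 - cos (w (y2 - x2)))], which vanishes when [x]
and [y] are equal on the torus (see [oscE]). *)
Definition osc x y : R := 2 - wave (freq w (1, 0)) (- dot (freq w (1, 0)) x) y -
  wave (freq w (0, 1)) (- dot (freq w (0, 1)) x) y.

(** The convolution with the normalised kernel is uniformly close to [f]: the
constant part [e] of the modulus survives, and the part in [osc] is integrated
to [2 * C / N]. *)
Lemma fejer_error f (e C : R) x : continuous f -> Q x ->
  (forall x y, Q x -> Q y -> `|f x - f y| <= e + C * osc x y) ->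
  `|\int[leb2]_(y in Q) (fejer x y * f y) - area * f x| <= area * (e + 2 * C / N%:R).
Proof.
move=> cf Qx Hf.
have cF : continuous (fejer x) by exact: continuous_fejer.
have cw n : continuous (wave (freq w n) (- dot (freq w n) x)) by exact: continuous_wave.
have cFw n : continuous (fun y => fejer x y * wave (freq w n) (- dot (freq w n) x) y).
  exact: continuousM2.
have -> : \int[leb2]_(y in Q) (fejer x y * f y) - area * f x =
    \int[leb2]_(y in Q) (fejer x y * (f y - f x)).
  under [in RHS]eq_Rintegral do rewrite mulrBr [_ * f x]mulrC.
  rewrite box_RintegralB; [|exact: continuousM2|
    by apply: continuousM2 => //; exact: continuous_cst2].
  by rewrite box_RintegralZl// integral_fejer [f x * _]mulrC.
have cfx : continuous (fun y => f y - f x).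
  by apply: continuousB2; [exact: cf|exact: continuous_cst2].
apply: (le_trans (box_normr_Rintegral _ _ _)); first exact: continuousM2.
apply: (@le_trans _ _ (\int[leb2]_(y in Q) ((e + 2 * C) * fejer x y - (
   C * (fejer x y * wave (freq w (1, 0)) (- dot (freq w (1, 0)) x) y) +
   C * (fejer x y * wave (freq w (0, 1)) (- dot (freq w (0, 1)) x) y))))).
  apply: box_le_Rintegral.
  - move=> y; apply: cvg_norm; exact: (continuousM2 cF cfx).
  - apply: continuousB2; first by apply: continuousM2 => //; exact: continuous_cst2.
    by apply: continuousD2; apply: continuousM2 => //; exact: continuous_cst2.
  - move=> y Qy; rewrite normrM (ger0_norm (fejer_ge0 _ _)) distrC.
    apply: (le_trans (ler_wpM2l (fejer_ge0 x y) (Hf _ _ Qx Qy))).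
    by rewrite /osc le_eqVlt; apply/orP; left; apply/eqP; ring.
have cC g : continuous g -> continuous (fun y => C * g y).
  by move=> cg; apply: continuousM2 => //; exact: continuous_cst2.
rewrite box_RintegralB; last 2 first.
- by apply: continuousM2 => //; exact: continuous_cst2.
- by apply: continuousD2; exact: cC.
have I0 : \int[leb2]_(y in Q) ((e + 2 * C) * fejer x y) = (e + 2 * C) * area.
  by rewrite (box_RintegralZl _ _ (e + 2 * C) cF) integral_fejer.
have I1 n : n = (1, 0) \/ n = (0, 1) -> \int[leb2]_(y in Q) (C * (fejer x y *
    wave (freq w n) (- dot (freq w n) x) y)) = C * (area * (1 - N%:R^-1)).
  by move=> n01; rewrite (box_RintegralZl _ _ C (cFw n)) integral_fejer_wave.
rewrite box_RintegralD; [|exact: cC..].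
rewrite I0 !I1; [|by right|by left].
by rewrite le_eqVlt; apply/orP; left; apply/eqP; field; rewrite pnatr_eq0 -lt0n N0 gt_eqF.
Qed.

(** The integral over the torus of [f] times its Fejer mean, written on the
Fourier side (see [fejer_meanE]). *)
Definition fejer_mean f : R := (area)^-1 * (N%:R ^- 2 *
  \sum_(p : T) \sum_(q : T) power Q f (freq w (index_diff p q))).

Let coefA f xi := \int[leb2]_(y in Q) (f y * wave xi 0 y).
Let coefB f xi := \int[leb2]_(y in Q) (f y * wave xi (pi / 2) y).

Let continuousZ2 k g : continuous g -> continuous (fun y => k * g y : R).
Proof. by move=> cg; apply: continuousM2 => //; exact: continuous_cst2. Qed.

Let continuous_fw f xi a : continuous f -> continuous (fun y => f y * wave xi a y).
Proof. by move=> cf; apply: continuousM2 => //; exact: continuous_wave. Qed.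

Lemma fejer_convE f x : continuous f ->
  \int[leb2]_(y in Q) (fejer x y * f y) =
  N%:R ^- 2 * \sum_(p : T) \sum_(q : T) (
    coefA f (freq w (index_diff p q)) * wave (freq w (index_diff p q)) 0 x +
    coefB f (freq w (index_diff p q)) * wave (freq w (index_diff p q)) (pi / 2) x).
Proof.
move=> cf; have cfw xi a := @continuous_fw f xi a cf.
under eq_Rintegral do rewrite /fejer -mulrA big_distrl /=.
under eq_Rintegral do under eq_bigr do rewrite big_distrl /=.
have cw xi b : continuous (fun y => wave xi b y * f y).
  by apply: continuousM2 => //; exact: continuous_wave.
rewrite box_RintegralZl; last first.
  by apply: continuous_sum2 => p; apply: continuous_sum2 => q; exact: cw.
rewrite box_Rintegral_sum; last first.
  by move=> p; apply: continuous_sum2 => q; exact: cw.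
congr (_ * _); apply: eq_bigr => p _.
rewrite box_Rintegral_sum; last by move=> q; exact: cw.
apply: eq_bigr => q _; set xi := freq _ _.
under eq_Rintegral.
  move=> y _; rewrite wave_diff.
  rewrite (_ : _ * f y = wave xi 0 x * (f y * wave xi 0 y) +
     wave xi (pi / 2) x * (f y * wave xi (pi / 2) y)); last by ring.
  over.
rewrite box_RintegralD; [|exact/continuousZ2..].
by rewrite !box_RintegralZl// mulrC [X in _ + X]mulrC.
Qed.

Lemma continuous_fejer_conv f : continuous f ->
  continuous (fun x => \int[leb2]_(y in Q) (fejer x y * f y)).
Proof.
move=> cf; under eq_fun do rewrite fejer_convE//.
apply: continuousZ2; apply: continuous_sum2 => p; apply: continuous_sum2 => q.
by apply: continuousD2; apply: continuousZ2; exact: continuous_wave.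
Qed.

Lemma fejer_meanE f : continuous f ->
  area * fejer_mean f = \int[leb2]_(x in Q) (f x * \int[leb2]_(y in Q) (fejer x y * f y)).
Proof.
move=> cf; rewrite /fejer_mean mulVKf; last first.
  by rewrite expf_neq0// !mulf_neq0 ?invr_neq0// gt_eqF// pi_gt0.
have cfw xi a := @continuous_fw f xi a cf.
under [RHS]eq_Rintegral do rewrite fejer_convE// mulrCA big_distrr /=.
under [RHS]eq_Rintegral do under eq_bigr do rewrite big_distrr /=.
have ct p q : continuous (fun x => f x * (
      coefA f (freq w (index_diff p q)) * wave (freq w (index_diff p q)) 0 x +
      coefB f (freq w (index_diff p q)) * wave (freq w (index_diff p q)) (pi / 2) x)).
  apply: continuousM2 => //; apply: continuousD2; apply: continuousZ2; exact: continuous_wave.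
rewrite box_RintegralZl; last first.
  by apply: continuous_sum2 => p; apply: continuous_sum2 => q; exact: ct.
rewrite box_Rintegral_sum; last first.
  by move=> p; apply: continuous_sum2 => q; exact: ct.
congr (_ * _); apply: eq_bigr => p _.
rewrite box_Rintegral_sum; last by move=> q; exact: ct.
apply: eq_bigr => q _; set xi := freq _ _.
under eq_Rintegral.
  move=> y _; rewrite (_ : f y * _ = coefA f xi * (f y * wave xi 0 y) +
     coefB f xi * (f y * wave xi (pi / 2) y)); last by ring.
  over.
rewrite box_RintegralD; [|exact/continuousZ2..].
by rewrite !box_RintegralZl.
Qed.

Lemma fejer_mean_error f (e C : R) : continuous f ->
  (forall x y, Q x -> Q y -> `|f x - f y| <= e + C * osc x y) ->
  `|\int[leb2]_(x in Q) (f x ^+ 2) - fejer_mean f| <=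
  (e + 2 * C / N%:R) * \int[leb2]_(x in Q) `|f x|.
Proof.
move=> cf Hf.
have area_gt0 : 0 < area by rewrite exprn_gt0// divr_gt0// mulr_gt0// pi_gt0.
have cS : continuous (fun x => \int[leb2]_(y in Q) (fejer x y * f y)) by exact: continuous_fejer_conv.
have csq : continuous (fun x => f x ^+ 2) by under eq_fun do rewrite expr2; exact: continuousM2.
rewrite -(ler_pM2l area_gt0) -{1}(gtr0_norm area_gt0) -normrM mulrBr fejer_meanE//.
have -> : area * \int[leb2]_(x in Q) f x ^+ 2 = \int[leb2]_(x in Q) (area * f x ^+ 2).
  by rewrite (box_RintegralZl _ _ area csq).
rewrite -box_RintegralB; last 2 first.
- by apply: continuousM2; [exact: continuous_cst2|exact: csq].
- exact: continuousM2.
have cn g : continuous g -> continuous (fun x => `|g x| : R).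
  by move=> cg x; apply: cvg_norm; exact: cg.
have cd : continuous (fun x => area * f x ^+ 2 - f x * \int[leb2]_(y in Q) (fejer x y * f y)).
  apply: continuousB2; last exact: continuousM2.
  by apply: continuousM2; [exact: continuous_cst2|exact: csq].
apply: (le_trans (box_normr_Rintegral _ _ cd)).
rewrite mulrA -box_RintegralZl; last exact: cn.
apply: box_le_Rintegral.
- exact: cn.
- by apply: continuousM2; [exact: continuous_cst2|exact: cn].
- move=> x Qx; rewrite (_ : _ - _ = f x * - (\int[leb2]_(y in Q) (fejer x y * f y) - area * f x)).
    by rewrite normrM normrN mulrC ler_wpM2r// fejer_error.
  by ring.
Qed.

End Fejer.

Section FejerConvergence.
Context {R : realType}.
Implicit Types (f : R * R -> R) (x y : R * R).
Variables (w : R) (w0 : 0 < w).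
Local Notation l := (pi / w).
Local Notation Q := (box (- l) l).

Lemma cos_eq1 (t : R) : `|t| <= 2 * pi -> cos t = 1 -> t = 0 \/ `|t| = 2 * pi.
Proof.
move=> t2 ct; have [->|t0] := eqVneq t 0; [by left|right].
apply/eqP; rewrite eq_le t2 leNgt; apply/negP => tlt.
have s0 : 0 < sin (`|t| / 2).
  apply: sin_gt0_pi; rewrite divr_gt0 ?normr_gt0//=.
  by rewrite ltr_pdivrMr// mulrC.
have : cos `|t| = 1 by rewrite cos_norm.
rewrite (_ : `|t| = (`|t| / 2) *+ 2); last by rewrite -mulr_natr divfK.
rewrite cos_mulr2n cos2sin2 => h.
have : sin (`|t| / 2) ^+ 2 = 0 by move: h; lra.
by move/eqP; rewrite sqrf_eq0 gt_eqF.
Qed.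

Lemma oscE x y : osc w x y = 2 - cos (w * (y.1 - x.1)) - cos (w * (y.2 - x.2)).
Proof.
by rewrite /osc /wave /dot /freq /=; congr (_ - cos _ - cos _); ring.
Qed.

(** Two points of the square that agree on the torus are either equal or both on
its boundary. *)
Lemma osc_eq0 f x y : (forall x, l <= `|x| -> f x = 0) -> Q x -> Q y ->
  osc w x y = 0 -> f x = f y.
Proof.
move=> f0 [+ +] [+ +]; rewrite /= !in_itv /= => /andP[a1 a2] /andP[b1 b2].
move=> /andP[c1 c2] /andP[d1 d2]; rewrite oscE => o0.
have h1 := cos_le1 (w * (y.1 - x.1)); have h2 := cos_le1 (w * (y.2 - x.2)).
have lw : w * l = pi by rewrite mulrC divfK// gt_eqF.
have bd (u v : R) : - l <= u -> u <= l -> - l <= v -> v <= l ->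
    cos (w * (v - u)) = 1 -> v = u \/ (l <= `|u| /\ l <= `|v|).
  move=> u1 u2 v1 v2 /cos_eq1; rewrite normrM (gtr0_norm w0).
  have vu : `|v - u| <= 2 * l by rewrite ler_norml; apply/andP; split; lra.
  have wvu : w * `|v - u| <= 2 * pi by rewrite -lw mulrCA ler_pM2l.
  case/(_ wvu) => [/eqP|].
    by rewrite mulf_eq0 gt_eqF//= subr_eq0 => /eqP; left.
  move=> h; right; have : `|v - u| = 2 * l.
    by apply: (mulfI (lt0r_neq0 w0)); rewrite h [RHS]mulrCA lw.
  move: {h wvu lw vu} u1 u2 v1 v2; move: (pi / w) => L u1 u2 v1 v2.
  case: (lerP 0 (v - u)) => vu0.
    by rewrite ger0_norm// => e; split; rewrite ler_normr; apply/orP; [right|left]; lra.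
  by rewrite ltr0_norm// => e; split; rewrite ler_normr; apply/orP; [left|right]; lra.
have big1 (u : R * R) : l <= `|u.1| -> f u = 0.
  by move=> lu; apply: f0; rewrite prod_normE le_max lu.
have big2 (u : R * R) : l <= `|u.2| -> f u = 0.
  by move=> lu; apply: f0; rewrite prod_normE le_max lu orbT.
have [e1|[? ?]] : y.1 = x.1 \/ (l <= `|x.1| /\ l <= `|y.1|); last by rewrite !big1.
  by apply: bd => //; lra.
have [e2|[? ?]] : y.2 = x.2 \/ (l <= `|x.2| /\ l <= `|y.2|); last by rewrite !big2.
  by apply: bd => //; lra.
by rewrite [x]surjective_pairing [y]surjective_pairing e1 e2.
Qed.

Lemma fejer_modulus f (e : R) : continuous f ->
  (forall x, l <= `|x| -> f x = 0) -> 0 < e ->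
  exists2 C, 0 <= C & forall x y, Q x -> Q y -> `|f x - f y| <= e + C * osc w x y.
Proof.
move=> cf f0 e0.
have [|||z [Qx Qy]|z [Qx Qy] o0|C C0 HC] :=
  @compact_dominated _ _ (Q `*` Q) (fun z => `|f z.1 - f z.2|)
  (fun z => osc w z.1 z.2) e _ _ _ e0.
- by apply: compact_setX; exact: compact_box.
- move=> z; apply: cvg_norm; apply: cvgB.
    by apply: (cvg_comp _ f cvg_fst); exact: cf.
  by apply: (cvg_comp _ f cvg_snd); exact: cf.
- under eq_fun do rewrite oscE.
  have cl (h : (R * R) * (R * R) -> R) : continuous h ->
      continuous (fun z => cos (w * h z)).
    move=> ch z; apply: (@continuous_comp _ _ _ (fun z => w * h z) cos).
      by apply: cvgM; [exact: cvg_cst|exact: ch].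
    exact: continuous_cos.
  apply: continuousB2; first apply: continuousB2; first exact: continuous_cst2.
    apply: cl; apply: continuousB2 => z.
      by apply: (cvg_comp snd fst); [exact: cvg_snd|exact: cvg_fst].
    by apply: (cvg_comp fst fst); [exact: cvg_fst|exact: cvg_fst].
  apply: cl; apply: continuousB2 => z.
    by apply: (cvg_comp snd snd); [exact: cvg_snd|exact: cvg_snd].
  by apply: (cvg_comp fst snd); [exact: cvg_fst|exact: cvg_snd].
- rewrite oscE; have := cos_le1 (w * (z.2.1 - z.1.1)).
  by have := cos_le1 (w * (z.2.2 - z.1.2)); lra.
- by rewrite (osc_eq0 f0 Qx Qy o0) subrr normr0.
- by exists C => // x y Qx Qy; exact: (HC (x, y)).
Qed.

(** The substitute for Plancherel's formula; the limit is stated as an inequality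
valid for all large [N]. *)
Lemma fejer_mean_cvg f (e : R) : continuous f ->
  (forall x, l <= `|x| -> f x = 0) -> 0 < e ->
  exists N0 : nat, forall N, (N0 <= N)%N -> (0 < N)%N ->
    `|\int[leb2]_(x in Q) (f x ^+ 2) - fejer_mean w N f| <= e.
Proof.
move=> cf f0 e0.
pose I := \int[leb2]_(x in Q) `|f x|.
have I0 : 0 <= I by exact: Rintegral_ge0.
pose d := e / (2 * (I + 1)).
have d0 : 0 < d by rewrite divr_gt0// mulr_gt0// ltr_wpDl.
have [C C0 HC] := fejer_modulus cf f0 d0.
(* Beyond this threshold the term [2 * C / N] is at most [d]. *)
exists (Num.truncn (2 * C / d)).+1 => N NN N0.
apply: (le_trans (fejer_mean_error w0 N0 cf HC)).
have N0r : 0 < N%:R :> R by rewrite ltr0n.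
have : 2 * C / N%:R <= d.
  rewrite ler_pdivrMr// [d * _]mulrC -ler_pdivrMr//.
  apply: (le_trans (ltW (truncnS_gt _))).
  by rewrite ler_nat.
move=> h; apply: (@le_trans _ _ ((d + d) * I)); first by rewrite ler_wpM2r// lerD2l.
have -> : (d + d) * I = e * (I / (I + 1)).
  by rewrite /d; field; rewrite gt_eqF// ltr_wpDl.
rewrite -[leRHS]mulr1 ler_pM2l// ler_pdivrMr ?ltr_wpDl// mul1r.
by rewrite lerDl.
Qed.

End FejerConvergence.

(** * The spectral inequality for test functions *)

Section TestFunctions.
Context {R : realType}.
Implicit Types (Omega : set (R * R)) (f psi : R * R -> R) (x xi : R * R).

Lemma Rintegral_support (d : measure_display) (T : measurableType d)
    (mu : {measure set T -> \bar R}) (A B : set T) (h : T -> R) :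
  (forall t, ~ A t -> h t = 0) -> (forall t, ~ B t -> h t = 0) ->
  \int[mu]_(t in A) h t = \int[mu]_(t in B) h t.
Proof.
move=> hA hB; rewrite Rintegral_mkcond [RHS]Rintegral_mkcond.
congr Rintegral; apply/funext => x; rewrite !patchE.
case: ifPn => [_|/negP xA]; case: ifPn => [_|/negP xB] //.
- by rewrite hB// => Bx; apply: xB; rewrite inE.
- by rewrite hA// => Ax; apply: xA; rewrite inE.
Qed.

Lemma box_norm (l : R) x : ~ box (- l) l x -> l <= `|x|.
Proof.
move=> Bx; rewrite prod_normE le_max; apply: contrapT => /negP.
rewrite negb_or -!ltNge => /andP[h1 h2]; apply: Bx.
by move: h1 h2; rewrite !ltr_norml => /andP[? ?] /andP[? ?]; split;
  rewrite /= in_itv /= !ltW.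
Qed.

(** Differentiating along the coordinate [i] multiplies the Fourier transform by
[xi_i], up to a phase. *)
Lemma power_partial (w : R) i f xi : 0 < w ->
  continuous f -> (forall x, derivable f x (basis_vec i)) ->
  continuous (partial i f) -> (forall x, pi / w <= `|x| -> f x = 0) ->
  power (box (- (pi / w)) (pi / w)) (partial i f) xi =
  xcoord i xi ^+ 2 * power (box (- (pi / w)) (pi / w)) f xi.
Proof.
move=> w0 cf df cdf f0; have l0 : 0 < pi / w by rewrite divr_gt0// pi_gt0.
rewrite /power !integral_box_partial_wave// add0r -splitr.
under [X in _ + (_ * X) ^+ 2]eq_Rintegral.
  move=> x _; rewrite (_ : _ * _ = -1 * (f x * wave xi 0 x)); last first.
    by rewrite -[pi]add0r waveDpi mulN1r mulrN.
  over.
rewrite (box_RintegralZl _ _ (-1) (continuousM2 cf (@continuous_wave _ xi 0))).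
rewrite !mulNr mul1r !mulrN !sqrrN !exprMn -mulrDr.
by rewrite addrC.
Qed.

(** The squared length of an integer vector. *)
Definition sqn (n : int * int) : R := n.1%:~R ^+ 2 + n.2%:~R ^+ 2.

Lemma sqr_norm_freq (w : R) n : xcoord ord0 (freq w n) ^+ 2 + xcoord ord_max (freq w n) ^+ 2 =
  w ^+ 2 * sqn n.
Proof. by rewrite /sqn /xcoord /freq /= !exprMn mulrDr. Qed.

(** If the support of [psi] lies in the square [Q] of half-side [pi / w], then for
all large [N], [Y |psi|^2 - |grad psi|^2] is at most the normalised lattice sum of
the positive part of [Y - |xi|^2] against the power spectrum of [psi], up to [e].
The sum keeps the average over [p] and [q] coming from the Fejer kernel. *)
Lemma test_function_spectral Omega psi : test_function Omega psi ->
  exists2 r : R, 0 < r & forall w, 0 < w -> r <= pi / w ->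
  forall Y e : R, 0 <= Y -> 0 < e -> exists N0 : nat, forall N, (N0 <= N)%N -> (0 < N)%N ->
  Y * \int[leb2]_(x in Omega) (psi x ^+ 2) -
    \sum_i \int[leb2]_(x in Omega) (partial i psi x ^+ 2) <=
  ((2 * pi / w) ^+ 2)^-1 * (N%:R ^- 2 * \sum_(p : 'I_N * 'I_N) \sum_(q : 'I_N * 'I_N)
     Num.max 0 (Y - w ^+ 2 * sqn (index_diff p q)) *
     power Omega psi (freq w (index_diff p q))) + e.
Proof.
move=> tpsi; have [r r0 supp] := test_function_bounded_support tpsi.
exists r => // w w0 rl Y e Y0 e0.
pose Q := box (- (pi / w)) (pi / w).
have suppl x : pi / w <= `|x| -> psi x = 0 /\ forall i, partial i psi x = 0.
  by move=> lx; apply: supp; exact: le_trans lx.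
have offO x : ~ Omega x -> psi x = 0 /\ forall i, partial i psi x = 0.
  by move=> Ox; exact: test_function_eq0 Ox.
have psi0 x : pi / w <= `|x| -> psi x = 0 by case/suppl.
have dpsi0 i x : pi / w <= `|x| -> partial i psi x = 0 by case/suppl.
have OQ f (h : R -> R * R -> R) : (forall x, ~ Omega x -> f x = 0) ->
    (forall x, pi / w <= `|x| -> f x = 0) -> (forall x, h 0 x = 0) ->
    \int[leb2]_(x in Omega) h (f x) x = \int[leb2]_(x in Q) h (f x) x.
  move=> fO fl h0; apply: Rintegral_support => x Hx; first by rewrite fO.
  by rewrite fl//; exact: box_norm.
have powerE xi : power Omega psi xi = power Q psi xi.
  by rewrite /power; congr (_ ^+ 2 + _ ^+ 2);
    apply: (OQ psi (fun t x => t * wave xi _ x)) => // x; rewrite ?mul0r//; case/offO.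
have cC i := test_function_C1 i tpsi.
have cpsi : continuous psi by have [] := cC ord0.
have cd i : continuous (partial i psi) by have [] := cC i.
have dd i x : derivable psi x (basis_vec i) by have [] := cC i.
pose d := e / (Y + 2).
have d0 : 0 < d by rewrite divr_gt0// ltr_wpDl.
have [N1 H1] := fejer_mean_cvg w0 cpsi psi0 d0.
have [N2 H2] := fejer_mean_cvg w0 (cd ord0) (dpsi0 ord0) d0.
have [N3 H3] := fejer_mean_cvg w0 (cd ord_max) (dpsi0 ord_max) d0.
exists (maxn N1 (maxn N2 N3)) => N; rewrite !geq_max => /and3P[NN1 NN2 NN3] N0.
have {H1}H1 := H1 _ NN1 N0; have {H2}H2 := H2 _ NN2 N0; have {H3}H3 := H3 _ NN3 N0.
rewrite (OQ psi (fun t _ => t ^+ 2))//; [|by move=> x /offO[]|by move=> x; rewrite expr0n].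
have OQd i : \int[leb2]_(x in Omega) (partial i psi x ^+ 2) =
    \int[leb2]_(x in Q) (partial i psi x ^+ 2).
  apply: (OQ _ (fun t _ => t ^+ 2)) => [x /offO[]|x|x]; [by []|exact: dpsi0|].
  by rewrite expr0n.
have -> : \sum_i \int[leb2]_(x in Omega) (partial i psi x ^+ 2) =
    \int[leb2]_(x in Q) (partial ord0 psi x ^+ 2) + \int[leb2]_(x in Q) (partial ord_max psi x ^+ 2).
  rewrite big_ord_recl big_ord1 !OQd.
  by rewrite (_ : lift ord0 ord0 = ord_max)//; exact: val_inj.
have key : Y * fejer_mean w N psi - (fejer_mean w N (partial ord0 psi) +
    fejer_mean w N (partial ord_max psi)) <=
  ((2 * pi / w) ^+ 2)^-1 * (N%:R ^- 2 * \sum_(p : 'I_N * 'I_N) \sum_(q : 'I_N * 'I_N)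
     Num.max 0 (Y - w ^+ 2 * sqn (index_diff p q)) *
     power Omega psi (freq w (index_diff p q))).
  have ppE i xi : power Q (partial i psi) xi = xcoord i xi ^+ 2 * power Q psi xi.
    exact: power_partial.
  rewrite /fejer_mean -mulrDr -mulrDr mulrCA -mulrBr.
  rewrite ler_wpM2l ?invr_ge0 ?sqr_ge0//.
  rewrite mulrCA -mulrBr ler_wpM2l ?invr_ge0 ?sqr_ge0//.
  rewrite big_distrr -big_split -sumrB /=; apply: ler_sum => p _.
  rewrite big_distrr -big_split -sumrB /=; apply: ler_sum => q _.
  rewrite powerE; move: (index_diff p q) => n; rewrite !ppE.
  rewrite -(mulrDl (xcoord ord0 (freq w n) ^+ 2)) sqr_norm_freq -mulrBl.
  by rewrite ler_wpM2r ?power_ge0// le_max lexx orbT.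
apply: le_trans (lerD key (lexx e)).
have ede : e = Y * d + 2 * d.
  by rewrite /d -mulrDl mulrCA divff ?mulr1// gt_eqF// ltr_wpDl.
rewrite ede.
rewrite ler_distl in H1; rewrite ler_distl in H2; rewrite ler_distl in H3.
move: H1 H2 H3 => /andP[_ H1] /andP[H2 _] /andP[H3 _].
have := ler_wpM2l Y0 H1; rewrite mulrDr; move: H2 H3 => {key ede H1 OQd}.
set A := Rintegral _ _ _; set B := fejer_mean _ _ _.
set A' := Rintegral _ _ _; set B' := fejer_mean _ _ _.
set A2 := Rintegral _ _ _; set B2 := fejer_mean _ _ _.
move: A B A' B' A2 B2 => A B A' B' A2 B2; clear; lra.
Qed.

End TestFunctions.

(** * Lattice points in discs and radial lattice sums *)

Section LatticePoints.
Context {R : realType}.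

Lemma sin_le (x : R) : 0 <= x -> sin x <= x.
Proof.
move=> x0.
have dsin y : y \in `]0, x[%R -> is_derive y 1 (@sin R) (cos y).
  by move=> _; exact: is_derive_sin.
have [c _] := MVT_segment x0 dsin (continuous_subspaceT (@continuous_sin R)).
by rewrite sin0 !subr0 => ->; rewrite ler_piMl// cos_le1.
Qed.

(* A primitive of [cos^2], the area of a quarter of the unit disc up to the abscissa
   [sin t]. *)
Let Phi (t : R) := (t + sin t * cos t) / 2.

(* This only uses [sin (b - a) <= b - a] and
   [(sin b - sin a) * (cos b - cos a) <= 0]. *)
Let Phi_step (a b : R) : a <= b -> sin a <= sin b -> cos b <= cos a ->
  cos b * (sin b - sin a) <= Phi b - Phi a.
Proof.
move=> ab sab cab.
have h1 : sin (b - a) <= b - a by apply: sin_le; rewrite subr_ge0.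
have h2 : (sin b - sin a) * (cos b - cos a) <= 0.
  by rewrite mulr_ge0_le0// ?subr_ge0// subr_le0.
move: h1; rewrite sinB /Phi => h1.
rewrite -subr_ge0.
rewrite (_ : _ - _ = (b - a - (sin b * cos a - cos b * sin a)) / 2 -
  ((sin b - sin a) * (cos b - cos a)) / 2); last by field.
by rewrite subr_ge0 ler_pM2r// (le_trans h2)// subr_ge0.
Qed.

(** The inscribed rectangles of width 1 have total area at most that of a quarter
of the disc of radius [r]. *)
Lemma sum_sqrt_le (r : R) (A : nat) : 0 < r -> A%:R <= r ->
  \sum_(1 <= a < A.+1) Num.sqrt (r ^+ 2 - a%:R ^+ 2) <= pi / 4 * r ^+ 2.
Proof.
move=> r0 Ar; pose th (a : nat) : R := asin (a%:R / r).
have rge a : (a <= A)%N -> -1 <= (a%:R / r : R) <= 1.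
  move=> aA; apply/andP; split.
    by apply: (@le_trans _ _ 0); rewrite ?divr_ge0// ?ltW// lerN10.
  by rewrite ler_pdivrMr// mul1r (le_trans _ Ar)// ler_nat.
have sinth a : (a <= A)%N -> sin (th a) = a%:R / r.
  by move=> aA; rewrite asinK// in_itv/= rge.
have costh a : (a <= A)%N -> r * cos (th a) = Num.sqrt (r ^+ 2 - a%:R ^+ 2).
  move=> aA; rewrite cos_asin ?rge// -{1}(gtr0_norm r0) -sqrtr_sqr -sqrtrM ?sqr_ge0//.
  by congr Num.sqrt; field; rewrite gt_eqF.
have thpi a : (a <= A)%N -> th a <= pi / 2.
  by move=> aA; exact: asin_lepi2 (rge _ aA).
have th_le a b : (a <= b)%N -> (b <= A)%N -> th a <= th b.
  move=> ab bA; have aA := leq_trans ab bA; rewrite leNgt; apply/negP => lt.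
  have := lt; rewrite -ltr_sin; first last.
  - by rewrite in_itv/= (thpi _ aA) asin_geNpi2// rge.
  - by rewrite in_itv/= (thpi _ bA) asin_geNpi2// rge.
  by rewrite !sinth// ltr_pM2r ?invr_gt0// ltr_nat ltnNge ab.
have cos_le a b : (a <= b)%N -> (b <= A)%N -> cos (th b) <= cos (th a).
  move=> ab bA; have aA := leq_trans ab bA.
  rewrite -(ler_pM2l r0) !costh// ler_wsqrtr// lerD2l lerN2.
  by rewrite ler_pXn2r ?nnegrE// ler_nat.
have step a : (a < A)%N -> Num.sqrt (r ^+ 2 - a.+1%:R ^+ 2) <=
    r ^+ 2 * (Phi (th a.+1) - Phi (th a)).
  move=> aA; have aA' := ltnW aA; rewrite -costh//.
  apply: (@le_trans _ _ (r ^+ 2 * (cos (th a.+1) * (sin (th a.+1) - sin (th a))))).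
    rewrite !sinth// -mulrBl -natrB// subSnn.
    by rewrite le_eqVlt; apply/orP; left; apply/eqP; field; rewrite gt_eqF.
  rewrite ler_pM2l ?exprn_gt0// Phi_step//.
  - exact: th_le.
  - by rewrite !sinth// ler_pM2r ?invr_gt0// ler_nat.
  - exact: cos_le.
have tele B : (B <= A)%N -> \sum_(1 <= a < B.+1) Num.sqrt (r ^+ 2 - a%:R ^+ 2) <=
    r ^+ 2 * Phi (th B).
  elim: B => [_|B ih BA].
    have a0 : asin 0 = 0 :> R.
      by rewrite -{1}sin0 sinK// in_itv/= oppr_le0 andbb divr_ge0// pi_ge0.
    by rewrite big_geq// /th mul0r a0 /Phi sin0 mul0r addr0 mul0r mulr0.
  rewrite big_nat_recr//= (le_trans (lerD (ih (ltnW BA)) (step _ BA)))//.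
  by rewrite -mulrDr addrC subrK.
apply: (le_trans (tele A (leqnn _))).
rewrite mulrC ler_pM2r ?exprn_gt0//.
have thA0 : 0 <= sin (th A) by rewrite sinth// divr_ge0// ltW.
have := @Phi_step (th A) (pi / 2) (thpi _ (leqnn _)).
rewrite sin_pihalf cos_pihalf mul0r => /(_ (sin_le1 _)).
have c0 : 0 <= cos (th A) by rewrite -(pmulr_rge0 _ r0) costh// sqrtr_ge0.
move=> /(_ c0); rewrite subr_ge0 /Phi cos_pihalf mulr0 addr0 => /le_trans; apply.
by rewrite le_eqVlt; apply/orP; left; apply/eqP; field.
Qed.

(** The distance to a point takes each nonzero value at most twice. *)
Lemma sum_dist_le (F : nat -> R) (N A c : nat) : (forall a, 0 <= F a) ->
  (forall a, (A < a)%N -> F a = 0) -> (c < N)%N ->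
  \sum_(i < N) F `|(i : nat)%:Z - c%:Z|%N <= F 0%N + 2 * \sum_(1 <= a < A.+1) F a.
Proof.
move=> F0 FA cN.
have bnd B : \sum_(1 <= a < B) F a <= \sum_(1 <= a < A.+1) F a.
  have [BA|BA] := leqP B A.+1.
    have [B1|B1] := posnP B.
      by rewrite B1 big_geq//; apply: sumr_ge0.
    rewrite (@big_cat_nat _ _ _ B 1 A.+1)//= lerDl; exact: sumr_ge0.
  rewrite (@big_cat_nat _ _ _ A.+1 1 B)//=; last exact: ltnW.
  rewrite gerDl big_nat_cond big1 ?lexx// => a /andP[/andP[Aa _] _].
  exact: FA.
rewrite -(big_mkord xpredT (fun i => F `|i%:Z - c%:Z|%N)).
rewrite (@big_cat_nat _ _ _ c 0 N)//=; last exact: ltnW.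
have -> : \sum_(0 <= i < c) F `|i%:Z - c%:Z|%N = \sum_(1 <= a < c.+1) F a.
  rewrite big_nat_rev /= big_add1 /= big_nat [RHS]big_nat; apply: eq_bigr => i /= ic.
  by congr F; lia.
have -> : \sum_(c <= i < N) F `|i%:Z - c%:Z|%N = F 0%N + \sum_(1 <= a < N - c) F a.
  rewrite -{1}(add0n c) big_addn (@big_ltn _ _ _ 0) ?subn_gt0//.
  congr (F _ + _); first lia.
  by apply: eq_bigr => i _; congr F; lia.
by have := bnd c.+1; have := bnd (N - c)%N; lra.
Qed.

(** Integers in an interval of half-length [sqrt s] centred at an integer. *)
Lemma count_sqr_le (s : R) (N c : nat) : 0 <= s -> (c < N)%N ->
  \sum_(i < N) ((`|(i : nat)%:Z - c%:Z| ^ 2)%N%:R <= s)%R%:R <= 2 * Num.sqrt s + 1 :> R.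
Proof.
move=> s0 cN; pose A := Num.truncn (Num.sqrt s).
have lt_sqrt a : (a%:R ^+ 2 <= s) = (a%:R <= Num.sqrt s :> R).
  rewrite -{1}(sqr_sqrtr s0) ler_pXn2r ?nnegrE ?sqrtr_ge0//.
apply: (le_trans (@sum_dist_le (fun a => ((a ^ 2)%N%:R <= s)%R%:R) N A c _ _ cN)).
- by move=> a; exact: ler0n.
- move=> a Aa; rewrite natrX lt_sqrt leNgt (lt_le_trans (truncnS_gt _))//.
  by rewrite ler_nat.
apply: (@le_trans _ _ (1 + 2 * \sum_(1 <= a < A.+1) 1)).
  apply: lerD; first by rewrite -[1]/(true%:R) ler_nat leq_b1.
  rewrite ler_pM2l//; apply: ler_sum => a _.
  by rewrite -[1]/(true%:R) ler_nat leq_b1.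
rewrite sumr_const_nat subSS subn0 addrC lerD2r ler_pM2l//.
by rewrite truncn_le ?sqrtr_ge0.
Qed.

(** The squared length of an integer vector, as a natural number. *)
Definition nsq (n : int * int) : nat := (`|n.1| ^ 2 + `|n.2| ^ 2)%N.

Lemma sqnE n : sqn n = (nsq n)%:R :> R.
Proof.
have E (z : int) : z%:~R ^+ 2 = (`|z| ^ 2)%N%:R :> R.
  by case: z => k; rewrite ?NegzE ?abszN ?mulrNz ?sqrrN -pmulrn natrX.
by rewrite /sqn /nsq !E natrD.
Qed.

(** A quantitative form of Gauss's bound for the circle problem: rows are counted
by [count_sqr_le], and their lengths are added by [sum_sqrt_le]. *)
Lemma count_disc_le (m N : nat) (q : 'I_N * 'I_N) :
  \sum_(p : 'I_N * 'I_N) (nsq (index_diff p q) <= m)%N%:R <=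
  pi * m%:R + 4 * Num.sqrt m%:R + 1 :> R.
Proof.
pose r : R := Num.sqrt m%:R; pose A := Num.truncn r.
have r2 : r ^+ 2 = m%:R by rewrite sqr_sqrtr.
have r0 : 0 <= r by rewrite sqrtr_ge0.
have Ar : A%:R <= r by rewrite truncn_le.
pose phi (a : nat) : R := if (a ^ 2 <= m)%N then 2 * Num.sqrt (m%:R - a%:R ^+ 2) + 1 else 0.
have phi0 a : 0 <= phi a.
  by rewrite /phi; case: ifP => // _; rewrite addr_ge0// mulr_ge0// sqrtr_ge0.
have sqA a : (a ^ 2 <= m)%N = (a <= A)%N.
  by rewrite -(ler_nat R) natrX -r2 ler_pXn2r ?nnegrE// truncn_ge_nat.
rewrite -(pair_bigA _ (fun i j => (nsq (index_diff (i, j) q) <= m)%N%:R)) /=.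
apply: (@le_trans _ _ (\sum_(i < N) phi `|(i : nat)%:Z - (q.1 : nat)%:Z|%N)).
  apply: ler_sum => i _; rewrite /phi /nsq /=.
  set a := `|_ - _|%N; case: ifPn => [am|am]; last first.
    rewrite big1// => j _; rewrite leqNgt; move: am; rewrite -ltnNge => am.
    by rewrite (leq_trans am)// leq_addr.
  have s0 : 0 <= m%:R - a%:R ^+ 2 :> R by rewrite subr_ge0 -natrX ler_nat.
  apply: (le_trans _ (count_sqr_le s0 (ltn_ord q.2))).
  by apply: ler_sum => j _; rewrite ler_nat lerBrDl -natrX -natrD ler_nat.
apply: (le_trans (@sum_dist_le phi N A q.1 phi0 _ _)) => //.
  by move=> a Aa; rewrite /phi sqA leqNgt Aa.
have -> : phi 0%N = 2 * r + 1 by rewrite /phi expr0n subr0.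
have -> : \sum_(1 <= a < A.+1) phi a =
    2 * \sum_(1 <= a < A.+1) Num.sqrt (r ^+ 2 - a%:R ^+ 2) + A%:R.
  rewrite big_distrr /=.
  have -> : A%:R = \sum_(1 <= a < A.+1) 1 :> R by rewrite sumr_const_nat subSS subn0.
  rewrite -big_split /= big_nat [RHS]big_nat; apply: eq_bigr => a /andP[_ aA].
  by rewrite /phi sqA -ltnS aA r2.
have hS : \sum_(1 <= a < A.+1) Num.sqrt (r ^+ 2 - a%:R ^+ 2) <= pi / 4 * m%:R.
  have [rp|] := ltP 0 r; first by rewrite -r2; exact: sum_sqrt_le.
  move=> rn; have A0 : A = 0%N.
    by apply/eqP; rewrite -leqn0 -(ler_nat R) (le_trans Ar).
  by rewrite A0 big_geq// mulr_ge0// divr_ge0// pi_ge0.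
by rewrite -/r; move: hS Ar; set S := \sum_(_ <= _ < _) _; set P := _ / 4 * _; rewrite
  (_ : pi * m%:R = 4 * P); [lra|rewrite /P; field].
Qed.

(** A sequence vanishing from [M] on, as a combination of indicators of initial
segments. *)
Lemma abel_indicator (g : nat -> R) (M k : nat) : (forall m, (M <= m)%N -> g m = 0) ->
  g k = \sum_(0 <= m < M) (g m - g m.+1) * (k <= m)%N%:R.
Proof.
move=> gM; have [Mk|kM] := leqP M k.
  rewrite gM// big_nat big1// => m /andP[_ mM].
  by rewrite leqNgt (leq_trans mM Mk) mulr0.
rewrite (@big_cat_nat _ _ _ k 0 M)//=; last exact: ltnW.
rewrite big_nat big1 ?add0r; last by move=> m /andP[_ mk]; rewrite leqNgt mk mulr0.
rewrite big_nat; under eq_bigr => m /andP[km _] do rewrite km mulr1.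
rewrite -big_nat.
have := @telescope_sumr R k M (fun m => - g m) (ltnW kM).
rewrite gM// oppr0 sub0r opprK => <-; apply: eq_bigr => m _.
by rewrite opprK addrC.
Qed.

Lemma abel_id (g : nat -> R) (M : nat) : g M = 0 ->
  \sum_(0 <= m < M) (g m - g m.+1) * m%:R = \sum_(1 <= m < M) g m.
Proof.
move=> gM; have E K : \sum_(0 <= m < K) (g m - g m.+1) * m%:R =
    \sum_(1 <= m < K.+1) g m - K%:R * g K.
  elim: K => [|K ih]; first by rewrite !big_geq// mul0r subr0.
  rewrite big_nat_recr//= ih [in RHS]big_nat_recr//= -natr1; ring.
rewrite E gM mulr0 subr0; case: M gM {E} => [|K] gM; first by rewrite !big_geq.
by rewrite big_nat_recr//= gM addr0.
Qed.

(** A radial nonincreasing sum over a window of the lattice is compared with the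
one-dimensional sum of [g], up to a boundary term. *)
Lemma lattice_sum_le (g : nat -> R) (M N : nat) (q : 'I_N * 'I_N) :
  (forall m, g m.+1 <= g m) -> (forall m, (M <= m)%N -> g m = 0) ->
  \sum_(p : 'I_N * 'I_N) g (nsq (index_diff p q)) <=
  pi * \sum_(1 <= m < M) g m + (4 * Num.sqrt M%:R + 1) * g 0%N.
Proof.
move=> gd gM.
under eq_bigr do rewrite (abel_indicator _ gM).
rewrite exchange_big /=.
apply: (@le_trans _ _ (\sum_(0 <= m < M) (g m - g m.+1) *
    (pi * m%:R + (4 * Num.sqrt M%:R + 1)))).
  rewrite big_nat [leRHS]big_nat; apply: ler_sum => m /andP[_ mM].
  rewrite -big_distrr /= ler_wpM2l ?subr_ge0//.
  apply: (le_trans (count_disc_le _ _)); rewrite -addrA lerD2l lerD2r ler_pM2l//.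
  by rewrite ler_wsqrtr// ler_nat ltnW.
set c := 4 * _ + 1.
have E m : (g m - g m.+1) * (pi * m%:R + c) = pi * ((g m - g m.+1) * m%:R) + (g m - g m.+1) * c.
  by ring.
rewrite (eq_bigr _ (fun m _ => E m)).
rewrite big_split /= -big_distrr -big_distrl /= (abel_id (gM _ (leqnn M))) lerD2l mulrC.
rewrite ler_wpM2l ?addr_ge0 ?mulr_ge0 ?sqrtr_ge0//.
have := @telescope_sumr R 0 M (fun m => - g m) (leq0n _).
rewrite gM// oppr0 sub0r opprK => <-; apply: ler_sum => m _.
by rewrite opprK addrC.
Qed.

End LatticePoints.

(** * Bessel's inequality and the space of square-integrable functions *)

Section Bessel.
Context {R : realType}.

(** Bessel's inequality for a positive semidefinite symmetric form [B] that is
bilinear on the vectors satisfying [P], and an orthogonal family with squared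
norms [c j], indexed from 1.  The proof removes the components of [f] one at a
time. *)
Lemma bessel_inequality (V : Type) (P : V -> Prop) (add : V -> V -> V)
    (scale : R -> V -> V) (B : V -> V -> R) (u : nat -> V) (c : nat -> R) (f : V) (k : nat) :
  (forall x y, P x -> P y -> P (add x y)) -> (forall a x, P x -> P (scale a x)) ->
  (forall x y, B x y = B y x) ->
  (forall x y z, P x -> P y -> P z -> B (add x y) z = B x z + B y z) ->
  (forall a x y, P x -> P y -> B (scale a x) y = a * B x y) ->
  (forall x, P x -> 0 <= B x x) ->
  (forall j, (0 < j)%N -> P (u j)) -> (forall j, (0 < j)%N -> 0 < c j) ->
  (forall i j, (0 < i)%N -> (0 < j)%N -> B (u i) (u j) = (i == j)%:R * c i) ->
  P f -> \sum_(1 <= j < k.+1) B f (u j) ^+ 2 / c j <= B f f.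
Proof.
move=> Padd Pscale Bsym BD BZ B0 Pu c0 Bu Pf.
have : exists g, [/\ P g, B g g = B f f - \sum_(1 <= j < k.+1) B f (u j) ^+ 2 / c j &
    forall j, (k < j)%N -> B g (u j) = B f (u j)].
  elim: k => [|k [g [Pg Bg gu]]].
    by exists f; split => //; rewrite big_geq// subr0.
  have Pk := Pu k.+1 isT; have ck := c0 k.+1 isT.
  have Ps := Pscale (- (B f (u k.+1) / c k.+1)) _ Pk.
  exists (add g (scale (- (B f (u k.+1) / c k.+1)) (u k.+1))); split.
  - exact: Padd.
  - set s := scale _ _; have Pa : P (add g s) by exact: Padd.
    rewrite (BD g s _ Pg Ps Pa) (Bsym g) (Bsym s) (BD g s _ Pg Ps Pg) (BD g s _ Pg Ps Ps).
    rewrite (Bsym g s) (BZ _ _ s Pk Ps) (Bsym _ s) !(BZ _ (u k.+1)) // (Bsym (u _) g) gu//.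
    rewrite Bu// eqxx mul1r Bg [in RHS]big_nat_recr//=; field.
    by rewrite gt_eqF.
  - move=> j kj; have j0 : (0 < j)%N by exact: leq_trans kj.
    have Pj := Pu j j0.
    by rewrite (BD _ _ _ Pg Ps Pj) (BZ _ _ _ Pk Pj) Bu// ltn_eqF// mul0r mulr0 addr0 gu// ltnW.
case=> g [Pg Bg _]; rewrite -subr_ge0 -Bg; exact: B0.
Qed.

End Bessel.

Section L2Calculus.
Context {R : realType}.
Implicit Types (f g h psi : R * R -> R) (x xi : R * R).
Variables (Omega : set (R * R)) (V : R).
Hypotheses (Oopen : open Omega) (OV : leb2 Omega = V%:E).
Local Notation mR2 := (measurableTypeR R * measurableTypeR R)%type.

Lemma measurable_Omega : @measurable _ mR2 Omega.
Proof. exact: open_measurable2. Qed.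
Let mO := measurable_Omega.

Let measurable_mul f g : @measurable_fun _ _ mR2 R Omega f ->
  @measurable_fun _ _ mR2 R Omega g -> @measurable_fun _ _ mR2 R Omega (fun x => f x * g x).
Proof. exact: measurable_funM. Qed.

Lemma L2_mul_integrable f g : L2 Omega f -> L2 Omega g ->
  leb2.-integrable Omega (EFin \o (fun x => f x * g x)).
Proof.
move=> [mf i_f] [mg ig].
apply: (@le_integrable _ _ _ leb2 Omega mO _ (EFin \o (fun x => f x ^+ 2 + g x ^+ 2))).
- by apply/measurable_EFinP; apply: measurable_mul.
- move=> x _ /=; rewrite lee_fin [leRHS]ger0_norm ?addr_ge0 ?sqr_ge0//.
  rewrite ler_norml; apply/andP; split.
    by have := sqr_ge0 (f x + g x); have := sqr_ge0 (f x); have := sqr_ge0 (g x); lra.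
  by have := sqr_ge0 (f x - g x); have := sqr_ge0 (f x); have := sqr_ge0 (g x); lra.
- exact: (integrableD mO i_f ig).
Qed.

Lemma L2D f g : L2 Omega f -> L2 Omega g -> L2 Omega (fun x => f x + g x).
Proof.
move=> Lf Lg; have mfg : @measurable_fun _ _ mR2 R Omega (fun x => f x + g x).
  by apply: measurable_funD; [case: Lf|case: Lg].
split => //.
have -> : EFin \o (fun x => (f x + g x) ^+ 2) =
    ((EFin \o (fun x => f x ^+ 2)) \+ (EFin \o (fun x => g x ^+ 2))) \+
    ((EFin \o (fun x => f x * g x)) \+ (EFin \o (fun x => f x * g x))) :> (R * R -> \bar R).
  by apply/funext => x /=; rewrite -!EFinD; congr EFin; ring.
apply: (integrableD mO); apply: (integrableD mO).
- by case: Lf.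
- by case: Lg.
- exact: L2_mul_integrable.
- exact: L2_mul_integrable.
Qed.

Lemma L2Z (k : R) f : L2 Omega f -> L2 Omega (fun x => k * f x).
Proof.
move=> [mf i_f]; split; first by apply: measurable_mul => //; exact: measurable_cst.
have -> : EFin \o (fun x => (k * f x) ^+ 2) =
    (fun x => (k ^+ 2)%:E * (EFin \o (fun x => f x ^+ 2)%R) x)%E :> (R * R -> \bar R).
  by apply/funext => x /=; rewrite exprMn EFinM.
exact: (integrableZl mO).
Qed.

Lemma L2B f g : L2 Omega f -> L2 Omega g -> L2 Omega (fun x => f x - g x).
Proof.
move=> Lf Lg; have := L2D Lf (L2Z (-1) Lg).
by under eq_fun do rewrite mulN1r.
Qed.

Lemma L2_bounded f (M : R) : continuous f -> (forall x, `|f x| <= M) -> L2 Omega f.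
Proof.
move=> cf fM; have mf : @measurable_fun _ _ mR2 R Omega f by exact: continuous_measurable2.
split => //; apply: measurable_bounded_integrable => //.
- by change (leb2 Omega < +oo)%E; rewrite OV ltry.
- by under eq_fun do rewrite expr2; exact: measurable_mul.
- exists (M ^+ 2); split; first exact: num_real.
  move=> y My x _ /=; apply: (le_trans _ (ltW My)).
  by rewrite normrX ler_pXn2r ?nnegrE// (le_trans _ (fM x)).
Qed.

Lemma L2_wave xi a : L2 Omega (wave xi a).
Proof. by apply: (@L2_bounded _ 1); [exact: continuous_wave|exact: wave_le1]. Qed.

Lemma innerC f g : inner Omega f g = inner Omega g f.
Proof. by rewrite /inner; under eq_Rintegral do rewrite mulrC. Qed.

Lemma innerD f g h : L2 Omega f -> L2 Omega g -> L2 Omega h ->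
  inner Omega (fun x => f x + g x) h = inner Omega f h + inner Omega g h.
Proof.
move=> Lf Lg Lh; rewrite /inner; under eq_Rintegral do rewrite mulrDl.
by rewrite RintegralD//; exact: L2_mul_integrable.
Qed.

Lemma innerZ (k : R) f h : L2 Omega f -> L2 Omega h ->
  inner Omega (fun x => k * f x) h = k * inner Omega f h.
Proof.
move=> Lf Lh; rewrite /inner; under eq_Rintegral do rewrite -mulrA.
by rewrite RintegralZl//; exact: L2_mul_integrable.
Qed.

Lemma innerB f g h : L2 Omega f -> L2 Omega g -> L2 Omega h ->
  inner Omega (fun x => f x - g x) h = inner Omega f h - inner Omega g h.
Proof.
move=> Lf Lg Lh; rewrite /inner; under eq_Rintegral do rewrite mulrBl.
by rewrite RintegralB//; exact: L2_mul_integrable.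
Qed.

Lemma inner_ge0 f : 0 <= inner Omega f f.
Proof. by apply: Rintegral_ge0 => x _; rewrite -expr2 sqr_ge0. Qed.

Lemma inner_sqr f : inner Omega f f = \int[leb2]_(x in Omega) (f x ^+ 2).
Proof. by rewrite /inner; under eq_Rintegral do rewrite -expr2. Qed.

Lemma inner_wave_sqr xi a :
  inner Omega (wave xi a) (wave xi a) + inner Omega (wave xi (a + pi / 2)) (wave xi (a + pi / 2)) = V.
Proof.
rewrite /inner -RintegralD//; last 2 first.
- exact/L2_mul_integrable/L2_wave/L2_wave.
- exact/L2_mul_integrable/L2_wave/L2_wave.
under eq_Rintegral do rewrite -!expr2 wave_sqr.
by rewrite Rintegral_cst// mul1r [X in fine X]OV.
Qed.

Lemma inner_wave_le xi a : inner Omega (wave xi a) (wave xi a) <= V.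
Proof. by rewrite -(inner_wave_sqr xi a) lerDl inner_ge0. Qed.

Lemma V_ge0 : 0 <= V.
Proof. by rewrite -lee_fin -OV; exact: measure_ge0. Qed.

(** From the nonnegative quadratic polynomial [|f - t g|^2] in [t]. *)
Lemma cauchy_schwarz f g : L2 Omega f -> L2 Omega g ->
  inner Omega f g ^+ 2 <= inner Omega f f * inner Omega g g.
Proof.
move=> Lf Lg; set a := inner Omega f f; set b := inner Omega f g; set c := inner Omega g g.
have a0 : 0 <= a by exact: inner_ge0.
have c0 : 0 <= c by exact: inner_ge0.
have H t : 0 <= a - 2 * t * b + t ^+ 2 * c.
  have Ltg := L2Z t Lg; have := inner_ge0 (fun x => f x - t * g x).
  rewrite innerB//; last exact: L2B.
  rewrite (innerC f) (innerC (fun x => t * g x)) !innerB// !innerZ//.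
  rewrite (innerC f (fun x => t * g x)) (innerC g (fun x => t * g x)) !innerZ//.
  rewrite (innerC g f) -/a -/b -/c.
  by rewrite (_ : _ - _ = a - 2 * t * b + t ^+ 2 * c)//; ring.
have [c00|cn] := eqVneq c 0.
  have H1 := H ((a + 1) / (2 * b)); have [->|bn] := eqVneq b 0.
    by rewrite expr0n mulr_ge0.
  move: H1; rewrite c00 mulr0 addr0.
  rewrite (_ : 2 * _ * b = a + 1); last by field.
  by lra.
have cp : 0 < c by rewrite lt_neqAle eq_sym cn.
have := H (b / c).
rewrite (_ : _ + _ = a - b ^+ 2 / c); last by field.
by rewrite subr_ge0 ler_pdivrMr.
Qed.

Lemma sqr_inner_wave_le f xi a : L2 Omega f ->
  inner Omega f (wave xi a) ^+ 2 <= V * inner Omega f f.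
Proof.
move=> Lf; apply: (le_trans (cauchy_schwarz Lf (L2_wave xi a))).
by rewrite mulrC ler_wpM2r ?inner_ge0 ?inner_wave_le.
Qed.

(** The three splitting lemmas below compare the quadratic quantities attached to
[f] and to an approximation [g] of it: the error term is the squared norm of
[f - g], with a weight [eta] that can be optimised against it. *)
Lemma sqr_le_split (eta a b : R) : 0 < eta ->
  a ^+ 2 <= (1 + eta) * b ^+ 2 + (1 + eta^-1) * (a - b) ^+ 2.
Proof.
move=> e0; rewrite -subr_ge0.
rewrite (_ : _ - _ = (eta * b - (a - b)) ^+ 2 / eta); last by field; rewrite gt_eqF.
by rewrite divr_ge0 ?sqr_ge0// ltW.
Qed.

Lemma inner_le_split (eta : R) f g : 0 < eta -> L2 Omega f -> L2 Omega g ->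
  inner Omega f f <= (1 + eta) * inner Omega g g +
    (1 + eta^-1) * inner Omega (fun x => f x - g x) (fun x => f x - g x).
Proof.
move=> e0 Lf Lg; have Ld := L2B Lf Lg.
have i1 := L2_mul_integrable Lg Lg; have i2 := L2_mul_integrable Ld Ld.
have iZ (k : R) h : leb2.-integrable Omega (EFin \o h) ->
    leb2.-integrable Omega (EFin \o (fun x => k * h x)).
  by move=> ih; apply: eq_integrable (integrableZl mO k ih) => //= x _; rewrite EFinM.
rewrite {2}/inner {2}/inner -!RintegralZl// -RintegralD//; [|exact: iZ..].
apply: le_Rintegral => //.
- exact: L2_mul_integrable.
- by apply: eq_integrable (integrableD mO (iZ (1 + eta) _ i1) (iZ (1 + eta^-1) _ i2)).
- by move=> x _; rewrite -!expr2; exact: sqr_le_split.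
Qed.

Lemma powerE_inner f xi : power Omega f xi =
  inner Omega f (wave xi 0) ^+ 2 + inner Omega f (wave xi (pi / 2)) ^+ 2.
Proof. by []. Qed.

Lemma power_le_split (eta : R) f g xi : 0 < eta -> L2 Omega f -> L2 Omega g ->
  power Omega f xi <= (1 + eta) * power Omega g xi +
    (1 + eta^-1) * (2 * V * inner Omega (fun x => f x - g x) (fun x => f x - g x)).
Proof.
move=> e0 Lf Lg; have Ld := L2B Lf Lg; have e1 : 0 <= 1 + eta^-1.
  by rewrite addr_ge0// invr_ge0 ltW.
rewrite !powerE_inner.
have E a := sqr_le_split (inner Omega f (wave xi a)) (inner Omega g (wave xi a)) e0.
have F a : (inner Omega f (wave xi a) - inner Omega g (wave xi a)) ^+ 2 <=
    V * inner Omega (fun x => f x - g x) (fun x => f x - g x).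
  by rewrite -innerB//; [exact: sqr_inner_wave_le|exact: L2_wave].
have h1 := le_trans (E 0) (lerD (lexx _) (ler_wpM2l e1 (F 0))).
have h2 := le_trans (E (pi / 2)) (lerD (lexx _) (ler_wpM2l e1 (F (pi / 2)))).
apply: (le_trans (lerD h1 h2)); rewrite le_eqVlt; apply/orP; left; apply/eqP; ring.
Qed.

End L2Calculus.

(** * Fourier transforms of the eigenfunctions *)

Section Eigenfunctions.
Context {R : realType}.
Implicit Types (f g h psi : R * R -> R) (x xi : R * R).
Variables (Omega : set (R * R)) (V : R).
Hypotheses (Oopen : open Omega) (OV : leb2 Omega = V%:E).
Let mO := measurable_Omega Oopen.

Lemma bounded_support_le f : continuous f -> (exists r : R, forall x, r <= `|x| -> f x = 0) ->
  exists M, forall x, `|f x| <= M.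
Proof.
move=> cf [r f0]; have [M [Mr HM]] := box_bounded (- r) r cf.
exists (`|M| + 1) => x; have [Bx|Bx] := pselect (box (- r) r x).
  by apply: (HM (`|M| + 1)) => //; rewrite ltr_pwDr// ler_norm.
by rewrite f0 ?normr0 ?addr_ge0//; exact: box_norm.
Qed.

Lemma L2_test_function psi : test_function Omega psi ->
  L2 Omega psi /\ forall i, L2 Omega (partial i psi).
Proof.
move=> tpsi; have [r r0 supp] := test_function_bounded_support tpsi.
have H f : continuous f -> (forall x, r <= `|x| -> f x = 0) -> L2 Omega f.
  move=> cf f0; have [|M fM] := bounded_support_le cf; first by exists r.
  exact: L2_bounded OV _ _ cf fM.
split=> [|i]; have [c1 _ c2] := test_function_C1 ord0 tpsi.
  by apply: H => // x /supp[].
by have [_ _ ci] := test_function_C1 i tpsi; apply: H => // x /supp[].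
Qed.

Lemma inner_partial_wave psi i xi a : test_function Omega psi ->
  inner Omega (partial i psi) (wave xi a) =
  - xcoord i xi * inner Omega psi (wave xi (a + pi / 2)).
Proof.
move=> tpsi; have [r r0 supp] := test_function_bounded_support tpsi.
have [c1 d1 c2] := test_function_C1 i tpsi.
have OQ f g : (forall x, ~ Omega x -> f x = 0) -> (forall x, r <= `|x| -> f x = 0) ->
    inner Omega f g = \int[leb2]_(x in box (- r) r) (f x * g x).
  move=> fO fr; apply: Rintegral_support => x Hx; first by rewrite fO// mul0r.
  by rewrite fr ?mul0r//; exact: box_norm.
rewrite !OQ; first apply: integral_box_partial_wave => //.
- by move=> x /supp[].
- by move=> x /(test_function_eq0 tpsi)[].
- by move=> x /supp[].
- by move=> x /(test_function_eq0 tpsi)[].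
- by move=> x /supp[].
Qed.

Lemma sqdistE f g : L2 Omega f -> L2 Omega g ->
  sqdist Omega f g = (inner Omega (fun x => f x - g x) (fun x => f x - g x))%:E.
Proof.
move=> Lf Lg; have [_ i2] := L2B Oopen Lf Lg.
rewrite inner_sqr /sqdist /Rintegral fineK//.
exact: (integrable_fin_num mO i2).
Qed.

Lemma H10_approx u G (d : R) : H10 Omega u G -> 0 < d ->
  exists psi, [/\ test_function Omega psi,
    inner Omega (fun x => psi x - u x) (fun x => psi x - u x) <= d &
    forall i, inner Omega (fun x => partial i psi x - G i x)
                          (fun x => partial i psi x - G i x) <= d].
Proof.
move=> [[Lu LG _] [psi [tpsi cu cG]]] d0.
have near_le (F : nat -> \bar R) : F n @[n --> \oo] --> 0%E ->
    \forall n \near \oo, (F n <= d%:E)%E.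
  move=> cF; have := cF [set y | (y <= d%:E)%E]; apply.
  have : nbhs (0%R%:E : \bar R) [set y | (y < d%:E)%E].
    by apply: open_nbhs_nbhs; split; [exact: open_ereal_lt_ereal|rewrite /= lte_fin].
  by apply: filterS => y /= /ltW.
have [n [h0 [h1 h2]]] : exists n, (sqdist Omega (psi n) u <= d%:E)%E /\
    (sqdist Omega (partial ord0 (psi n)) (G ord0) <= d%:E)%E /\
    (sqdist Omega (partial ord_max (psi n)) (G ord_max) <= d%:E)%E.
  have := filterI (near_le _ cu) (filterI (near_le _ (cG ord0)) (near_le _ (cG ord_max))).
  by case=> N _ /(_ N (leqnn N)) ?; exists N.
have [L1 L2i] := L2_test_function (tpsi n).
exists (psi n); split => //.
  by rewrite -lee_fin -sqdistE.
by apply: ord2P; rewrite -lee_fin -sqdistE.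
Qed.

(** The weak gradient of a function in the closure of the test functions is
integrated by parts against a wave, although a wave does not have compact
support: the identity holds for test functions and passes to the limit. *)
Lemma inner_gradient_wave u G i xi a : H10 Omega u G ->
  inner Omega (G i) (wave xi a) = - xcoord i xi * inner Omega u (wave xi (a + pi / 2)).
Proof.
move=> H; have [[Lu LG _] _] := H.
set D := inner Omega (G i) (wave xi a) - - xcoord i xi * inner Omega u (wave xi (a + pi / 2)).
have V0 := V_ge0 OV.
apply/eqP; rewrite -subr_eq0 -/D -sqrf_eq0 eq_le sqr_ge0 andbT.
apply/ler_addgt0Pr => e e0; rewrite add0r.
(* With the approximation error [e / c], the squared defect is at most
   [2 V (1 + xi_i^2) e / c <= e]. *)
pose c := 2 * V * (1 + xcoord i xi ^+ 2) + 1.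
have c0 : 0 < c by rewrite ltr_wpDl// !mulr_ge0// addr_ge0// sqr_ge0.
have [psi [tpsi h1 h2]] := H10_approx H (divr_gt0 e0 c0).
have [Lp Ldp] := L2_test_function tpsi.
have Lw b := L2_wave Oopen OV xi b.
have DE : D = xcoord i xi * - inner Omega (fun x => psi x - u x) (wave xi (a + pi / 2)) -
    inner Omega (fun x => partial i psi x - G i x) (wave xi a).
  by rewrite !innerB// inner_partial_wave// /D; ring.
have k1 := sqr_inner_wave_le Oopen OV xi (a + pi / 2) (L2B Oopen Lp Lu).
have k2 := sqr_inner_wave_le Oopen OV xi a (L2B Oopen (Ldp i) (LG i)).
have {k1}k1 := le_trans k1 (ler_wpM2l V0 h1).
have {k2}k2 := le_trans k2 (ler_wpM2l V0 (h2 i)).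
rewrite DE; move: k1 k2.
set s := inner _ _ _; set t := inner _ _ _; set z := xcoord i xi => k1 k2.
apply: (@le_trans _ _ (2 * (z ^+ 2 * s ^+ 2 + t ^+ 2))).
  by rewrite -subr_ge0 (_ : _ - _ = (z * s - t) ^+ 2); [exact: sqr_ge0|ring].
apply: (@le_trans _ _ (2 * (z ^+ 2 * (V * (e / c)) + V * (e / c)))).
  by rewrite ler_pM2l// lerD// ler_wpM2l// sqr_ge0.
rewrite (_ : 2 * _ = (2 * V * (1 + z ^+ 2)) / c * e); last by ring.
rewrite -[leRHS]mul1r; apply: ler_wpM2r; first exact: ltW.
by rewrite ler_pdivrMr// mul1r /c lerDl.
Qed.

Lemma eigen_L2 phi dphi : H10 Omega phi dphi -> L2 Omega phi /\ forall i, L2 Omega (dphi i).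
Proof. by case=> [[]]. Qed.

Variables (lambda : nat -> R) (phi : nat -> R * R -> R) (dphi : nat -> 'I_2 -> R * R -> R).
Hypothesis lambda_gt0 : forall j, (0 < j)%N -> 0 < lambda j.
Hypothesis lambda_le : forall i j, (0 < i)%N -> (i <= j)%N -> lambda i <= lambda j.
Hypothesis phi_on : forall i j, (0 < i)%N -> (0 < j)%N ->
  inner Omega (phi i) (phi j) = (i == j)%:R.
Hypothesis phi_H10 : forall j, (0 < j)%N -> H10 Omega (phi j) (dphi j).
Hypothesis dphi_on : forall i j, (0 < i)%N -> (0 < j)%N ->
  \sum_(l < 2) inner Omega (dphi i l) (dphi j l) = (i == j)%:R * lambda i.

Lemma bessel_phi f k : L2 Omega f ->
  \sum_(1 <= j < k.+1) inner Omega f (phi j) ^+ 2 <= inner Omega f f.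
Proof.
move=> Lf.
have := @bessel_inequality R _ (L2 Omega) (fun f g x => f x + g x) (fun a f x => a * f x)
  (inner Omega) phi (fun=> 1) f k.
under eq_bigr do rewrite divr1; apply.
- by move=> *; exact: L2D.
- by move=> *; exact: L2Z.
- exact: innerC.
- by move=> *; exact: innerD.
- by move=> *; exact: innerZ.
- by move=> *; exact: inner_ge0.
- by move=> j /phi_H10/eigen_L2[].
- by move=> _ _; exact: ltr01.
- by move=> i j i0 j0; rewrite phi_on// mulr1.
- exact: Lf.
Qed.

Lemma bessel_dphi (F : 'I_2 -> R * R -> R) k : (forall l, L2 Omega (F l)) ->
  \sum_(1 <= j < k.+1) (\sum_(l < 2) inner Omega (F l) (dphi j l)) ^+ 2 / lambda j <=
  \sum_(l < 2) inner Omega (F l) (F l).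
Proof.
move=> LF.
have := (@bessel_inequality R _ (fun F => forall l, L2 Omega (F l))
  (fun F G l x => F l x + G l x) (fun a F l x => a * F l x)
  (fun F G => \sum_(l < 2) inner Omega (F l) (G l)) dphi lambda F k); apply => //.
- by move=> *; exact: L2D.
- by move=> *; exact: L2Z.
- by move=> *; apply: eq_bigr => l _; exact: innerC.
- by move=> *; rewrite -big_split; apply: eq_bigr => l _; exact: innerD.
- by move=> *; rewrite big_distrr; apply: eq_bigr => l _; exact: innerZ.
- by move=> *; apply: sumr_ge0 => *; exact: inner_ge0.
- by move=> j /phi_H10/eigen_L2[].
Qed.

(** Bessel's inequality for the cosine and the sine of frequency [xi], whose
squared norms add up to [V]. *)
Lemma sum_power_le_V xi k : \sum_(1 <= j < k.+1) power Omega (phi j) xi <= V.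
Proof.
rewrite -(inner_wave_sqr Oopen OV xi 0) add0r.
apply: le_trans (lerD (bessel_phi k (L2_wave Oopen OV xi 0)) (bessel_phi k (L2_wave Oopen OV xi (pi / 2)))).
rewrite -big_split /=; apply: ler_sum => j _.
by rewrite powerE_inner !(innerC Omega (phi j)).
Qed.

(** Bessel's inequality for the gradients of the cosine and the sine of frequency
[xi], whose squared norms add up to [|xi|^2 V], with respect to the gradients of
the eigenfunctions. *)
Lemma sum_power_le_lambda xi k : (0 < k)%N ->
  (xi.1 ^+ 2 + xi.2 ^+ 2) * \sum_(1 <= j < k.+1) power Omega (phi j) xi <= V * lambda k.
Proof.
move=> k0; set z := xi.1 ^+ 2 + xi.2 ^+ 2.
have z0 : 0 <= z by rewrite addr_ge0// sqr_ge0.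
have [zz|zn] := eqVneq z 0; first by rewrite zz mul0r mulr_ge0 ?(V_ge0 OV)// ltW// lambda_gt0.
have zp : 0 < z by rewrite lt_neqAle eq_sym zn.
(* [F a] is the gradient of the wave of phase [a - pi / 2]; the phases 0 and
   [- (pi / 2)] are used so that the transforms have phases [pi / 2] and 0. *)
pose F a (l : 'I_2) x := xcoord l xi * wave xi a x.
have Lw a := L2_wave Oopen OV xi a.
have LF a l : L2 Omega (F a l) by exact/L2Z/Lw.
have FE a j : (0 < j)%N -> \sum_(l < 2) inner Omega (F a l) (dphi j l) =
    - z * inner Omega (phi j) (wave xi (a + pi / 2)).
  move=> j0; have [Lp Ld] := eigen_L2 (phi_H10 j0).
  rewrite big_ord_recl big_ord1 !innerZ// !(innerC _ _ (dphi j _)).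
  rewrite !(inner_gradient_wave _ _ _ (phi_H10 j0)) /xcoord /= /z; ring.
have FF a : \sum_(l < 2) inner Omega (F a l) (F a l) = z * inner Omega (wave xi a) (wave xi a).
  rewrite big_ord_recl big_ord1 !innerZ// !(innerC _ (wave _ _) (F _ _)) !innerZ//.
  by rewrite /xcoord /= /z; ring.
have := lerD (bessel_dphi k (LF 0)) (bessel_dphi k (LF (- (pi / 2)))).
rewrite !FF -mulrDr.
have -> : inner Omega (wave xi 0) (wave xi 0) +
    inner Omega (wave xi (- (pi / 2))) (wave xi (- (pi / 2))) = V.
  by rewrite addrC -(inner_wave_sqr Oopen OV xi (- (pi / 2))) addNr.
rewrite -big_split /= => hV.
have : \sum_(1 <= j < k.+1) z ^+ 2 * power Omega (phi j) xi / lambda k <= z * V.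
  apply: le_trans hV; apply: ler_sum_nat => j /andP[j0 jk].
  rewrite !FE// add0r addNr -mulrDl powerE_inner !exprMn !sqrrN -mulrDr [X in _ <= _ * X * _]addrC.
  rewrite ler_wpM2l// ?mulr_ge0 ?addr_ge0 ?sqr_ge0//.
  by rewrite lef_pV2 ?posrE ?lambda_gt0// lambda_le.
rewrite -big_distrl -big_distrr /= expr2 -!mulrA ler_pM2l//.
by rewrite mulrA ler_pdivrMr// lambda_gt0.
Qed.

End Eigenfunctions.

(** * The weight and its antiderivative *)

Section Weight.
Context {R : realType}.
Variables (Y L : R).
Hypotheses (L0 : 0 < L) (LY : L <= Y).

(** [(Y - t)_+ min(1, L / t)] for positive [t]; the test [t <= L] avoids the
division at [t = 0]. *)
Definition weight (t : R) : R :=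
  Num.max 0 (Y - t) * (if t <= L then 1 else L / t).

(** The antiderivative of [weight] on [[0, Y]] that vanishes at 0. *)
Definition weight_prim (t : R) : R :=
  if t <= L then Y * t - t ^+ 2 / 2
  else Y * L - L ^+ 2 / 2 + L * (Y * (ln t - ln L) - (t - L)).

Let factor_ge0 t : 0 <= (if t <= L then 1 else L / t).
Proof.
by case: ifPn => //; rewrite -ltNge => Lt; rewrite divr_ge0// ltW// (lt_trans L0).
Qed.

Lemma weight_ge0 t : 0 <= weight t.
Proof. by rewrite mulr_ge0// le_max lexx. Qed.

Lemma weight_anti a b : a <= b -> weight b <= weight a.
Proof.
move=> ab; apply: ler_pM => //; first by rewrite le_max lexx.
  by rewrite ge_max !le_max lexx/= lerD2l lerN2 ab orbT.
case: ifPn => [bL|]; first by rewrite (le_trans ab bL).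
rewrite -ltNge => Lb; have b0 := lt_trans L0 Lb; case: ifPn => [_|].
  by rewrite ler_pdivrMr// mul1r ltW.
rewrite -ltNge => La; rewrite ler_pM2l// lef_pV2// posrE//.
exact: lt_trans La.
Qed.

(* Below [L] the weight is [Y - t], above [L] it is [L (Y / t - 1)]; on each piece
   the rectangle at the right endpoint is bounded directly. *)
Let step_low a b : a <= b -> b <= L ->
  (b - a) * weight b <= weight_prim b - weight_prim a.
Proof.
move=> ab bL; rewrite /weight /weight_prim bL (le_trans ab bL) mulr1.
rewrite max_r ?subr_ge0 ?(le_trans bL)//.
have := sqr_ge0 (b - a); rewrite -subr_ge0 => h; rewrite -subr_ge0.
rewrite (_ : _ - _ = ((b - a) ^+ 2) / 2); last by field.
by rewrite divr_ge0// sqr_ge0.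
Qed.

Let prim_high t : L <= t ->
  weight_prim t = Y * L - L ^+ 2 / 2 + L * (Y * (ln t - ln L) - (t - L)).
Proof.
rewrite /weight_prim; case: ifPn => // tL Lt.
have -> : t = L by apply/eqP; rewrite eq_le tL Lt.
by ring.
Qed.

Let step_high a b : L <= a -> a <= b -> b <= Y ->
  (b - a) * weight b <= weight_prim b - weight_prim a.
Proof.
move=> La ab bY; have a0 := lt_le_trans L0 La; have b0 := lt_le_trans a0 ab.
have Lb := le_trans La ab.
rewrite !prim_high//.
have -> : weight b = L * (Y / b - 1).
  rewrite /weight max_r ?subr_ge0//; case: ifPn => bL; last by field; rewrite gt_eqF.
  have -> : b = L by apply/eqP; rewrite eq_le bL Lb.
  by field; rewrite gt_eqF.
have h : 1 - a / b <= ln b - ln a.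
  have ab0 : 0 < a / b by rewrite divr_gt0.
  have : ln (1 + (a / b - 1)) <= a / b - 1 by apply: le_ln1Dx; rewrite ltrBrDl subrr.
  by rewrite addrC subrK ln_div ?posrE//; lra.
rewrite -subr_ge0 (_ : _ - _ = L * Y * ((ln b - ln a) - (1 - a / b))); last by field; rewrite gt_eqF.
apply: mulr_ge0; last by rewrite subr_ge0.
by apply: mulr_ge0; apply: ltW => //; exact: lt_le_trans L0 LY.
Qed.

(** A right-endpoint rectangle lies below the graph of the nonincreasing
weight. *)
Lemma weight_step a b : a <= b -> b <= Y ->
  (b - a) * weight b <= weight_prim b - weight_prim a.
Proof.
move=> ab bY; have [bL|Lb] := leP b L; first exact: step_low.
have [La|aL] := leP L a; first exact: step_high.
have h1 := step_high (lexx L) (ltW Lb) bY.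
have h2 := step_low (ltW aL) (lexx L).
have h3 : (L - a) * weight b <= (L - a) * weight L.
  by rewrite ler_wpM2l ?subr_ge0 ?(ltW aL)// weight_anti// ltW.
rewrite (_ : (b - a) * _ = (b - L) * weight b + (L - a) * weight b); last by ring.
by move: h1 h2 h3; lra.
Qed.

Lemma weight_sum_le (h : R) (M : nat) : 0 < h ->
  (forall m, (m < M)%N -> h * m%:R <= Y) ->
  h * \sum_(1 <= m < M) weight (h * m%:R) <= weight_prim Y.
Proof.
move=> h0; have p0 : weight_prim 0 = 0.
  by rewrite /weight_prim (ltW L0) mulr0 expr0n mul0r subr0.
have le_primY a : 0 <= a -> a <= Y -> weight_prim a <= weight_prim Y.
  move=> a0 aY; rewrite -subr_ge0; apply: le_trans (weight_step aY (lexx Y)).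
  by rewrite mulr_ge0 ?weight_ge0 ?subr_ge0.
case: M => [_|K HK].
  rewrite big_geq// mulr0 -p0 le_primY//; exact: le_trans (ltW L0) LY.
suff H K' : (K' <= K)%N -> h * \sum_(1 <= m < K'.+1) weight (h * m%:R) <= weight_prim (h * K'%:R).
  apply: (le_trans (H K (leqnn K))); apply: le_primY; last exact: HK.
  by rewrite mulr_ge0// ltW.
elim: K' => [_|K' ih KK]; first by rewrite big_geq// !mulr0 p0.
rewrite big_nat_recr//= mulrDr.
have le1 : h * K'%:R <= h * K'.+1%:R by rewrite ler_pM2l// ler_nat.
have KK' : (K'.+1 < K.+1)%N by rewrite ltnS.
have := weight_step le1 (HK _ KK').
rewrite -mulrBr -natrB// subSnn mulr1.
by have := ih (ltnW KK); lra.
Qed.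

End Weight.

Section Limit.
Context {R : realType}.

Lemma le_of_eta (A B C : R) : (forall eta, 0 < eta -> eta <= 1 -> A <= B + C * eta) -> A <= B.
Proof.
move=> H; apply/ler_addgt0Pr => e e0.
pose c := `|C| + 1; have c0 : 0 < c by rewrite ltr_wpDl.
pose t := Num.min 1 (e / c).
have t0 : 0 < t by rewrite lt_min ltr01 divr_gt0.
apply: (le_trans (H t t0 _)); first by rewrite ge_min lexx.
rewrite lerD2l; apply: (@le_trans _ _ (c * t)).
  apply: ler_wpM2r; first exact: ltW.
  by apply: (le_trans (ler_norm _)); rewrite lerDl.
by rewrite mulrC -ler_pdivlMr// ge_min lexx orbT.
Qed.

End Limit.

(** * The weighted inequality for the eigenvalues *)

Section EigenvalueInequality.
Context {R : realType}.
Implicit Types (f g psi : R * R -> R) (x xi : R * R).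
Variables (Omega : set (R * R)) (V : R).
Hypotheses (Oopen : open Omega) (OV : leb2 Omega = V%:E).
Variables (lambda : nat -> R) (phi : nat -> R * R -> R) (dphi : nat -> 'I_2 -> R * R -> R).
Hypothesis lambda_gt0 : forall j, (0 < j)%N -> 0 < lambda j.
Hypothesis lambda_le : forall i j, (0 < i)%N -> (i <= j)%N -> lambda i <= lambda j.
Hypothesis phi_on : forall i j, (0 < i)%N -> (0 < j)%N ->
  inner Omega (phi i) (phi j) = (i == j)%:R.
Hypothesis phi_H10 : forall j, (0 < j)%N -> H10 Omega (phi j) (dphi j).
Hypothesis dphi_on : forall i j, (0 < i)%N -> (0 < j)%N ->
  \sum_(l < 2) inner Omega (dphi i l) (dphi j l) = (i == j)%:R * lambda i.

(** The two quadratic forms of an approximation [psi] of [u] with error [eta^2],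
in terms of those of [u]. *)
Lemma approx_form u G (mu eta : R) psi : H10 Omega u G -> inner Omega u u = 1 ->
  \sum_(l < 2) inner Omega (G l) (G l) = mu -> 0 < eta -> eta <= 1 ->
  test_function Omega psi ->
  inner Omega (fun x => psi x - u x) (fun x => psi x - u x) <= eta ^+ 2 ->
  (forall i, inner Omega (fun x => partial i psi x - G i x)
                         (fun x => partial i psi x - G i x) <= eta ^+ 2) ->
  1 - 3 * eta <= \int[leb2]_(x in Omega) (psi x ^+ 2) /\
  \sum_i \int[leb2]_(x in Omega) (partial i psi x ^+ 2) <= (1 + eta) * mu + 4 * eta.
Proof.
move=> H u1 Gmu e0 e1 tpsi h0 hi.
have [Lu LG] := eigen_L2 H; have [Lp Ldp] := L2_test_function Oopen OV tpsi.
have ee : (1 + eta^-1) * eta ^+ 2 = eta ^+ 2 + eta by field; rewrite gt_eqF.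
have ei : 0 <= 1 + eta^-1 by rewrite addr_ge0// invr_ge0 ltW.
have sw f g : inner Omega (fun x => f x - g x) (fun x => f x - g x) =
    inner Omega (fun x => g x - f x) (fun x => g x - f x).
  by rewrite !inner_sqr; under eq_Rintegral do rewrite -sqrrN opprB.
split.
  have := inner_le_split Oopen e0 Lu Lp; rewrite u1 sw -inner_sqr.
  have := ler_wpM2l ei h0; rewrite ee.
  set a := inner _ psi psi; set b := _ * inner _ _ _ => k1 k2.
  have a0 : 0 <= a by exact: inner_ge0.
  have : 1 <= (1 + eta) * a + (eta ^+ 2 + eta) by apply: (le_trans k2); rewrite lerD2l.
  move=> h; rewrite -(ler_pM2l (_ : 0 < 1 + eta)); last by rewrite addr_gt0.
  have s := sqr_ge0 eta; rewrite expr2 in s; rewrite expr2 in h.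
  by rewrite (_ : (1 + eta) * (1 - 3 * eta) = 1 - 2 * eta - 3 * (eta * eta)); [lra|ring].
have bd i : \int[leb2]_(x in Omega) (partial i psi x ^+ 2) <=
    (1 + eta) * inner Omega (G i) (G i) + 2 * eta.
  rewrite -inner_sqr; apply: (le_trans (inner_le_split Oopen e0 (Ldp i) (LG i))).
  rewrite lerD2l; apply: (le_trans (ler_wpM2l ei (hi i))); rewrite ee.
  have : eta * eta <= eta * 1 by rewrite ler_pM2l.
  by rewrite expr2; lra.
apply: (le_trans (ler_sum _ (fun i _ => bd i))).
rewrite big_split /= -big_distrr /= Gmu sumr_const card_ord.
by rewrite lerD2l -mulr_natl; lra.
Qed.

Let norm_const (P w e B : R) : 0 < P -> 0 < w ->
  ((2 * P / w) ^+ 2)^-1 * ((1 + e) * V * B) = V / (4 * P ^+ 2) * ((1 + e) * (w ^+ 2 * B)).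
Proof. by move=> P0 w0; field; rewrite !gt_eqF. Qed.

Let final_const (P I A k Y L e : R) : 0 < P ->
  V / (4 * P ^+ 2) * (P * I + e * (P * I + 2 * A)) + k * e -
    k * (Y - L - e * (3 * Y + L + 4)) =
  V / (4 * P) * I + (k * (3 * Y + L + 4) + k + V / (4 * P ^+ 2) * (P * I + 2 * A)) * e -
    k * (Y - L).
Proof. by move=> P0; field; rewrite gt_eqF. Qed.

(** All approximations are driven by one parameter [eta] in [(0, 1]]: the error on
each eigenfunction is [eta^2], the step [w] of the lattice is at most [eta], and
so is the error in the spectral inequality.  The difference between the two
sides is then at most a constant times [eta]. *)
Lemma eigenvalue_weight_le k Y : (0 < k)%N -> lambda k <= Y ->
  k%:R * (Y - lambda k) <= V / (4 * pi) * weight_prim Y (lambda k) Y.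
Proof.
move=> k0 LY; set L := lambda k; have L0 : 0 < L by exact: lambda_gt0.
have Y0 : 0 < Y by exact: lt_le_trans LY.
have V0 := V_ge0 OV.
pose I := weight_prim Y L Y.
have pi0 : 0 < pi :> R by exact: pi_gt0.
(* [A] and [C] collect the terms of first order in [eta]; those of higher order are
   absorbed because [eta <= 1]. *)
pose A := pi * (2 * k%:R * Y * (Y + 1)) + (2 * Y + 5) * (Y * (1 + 2 * k%:R)).
pose C := k%:R * (3 * Y + L + 4) + k%:R + V / (4 * pi ^+ 2) * (pi * I + 2 * A).
apply: (@le_of_eta _ _ _ C) => eta e0 e1.
have approx j : exists psi, (0 < j)%N -> [/\ test_function Omega psi,
    inner Omega (fun x => psi x - phi j x) (fun x => psi x - phi j x) <= eta ^+ 2 &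
    forall i, inner Omega (fun x => partial i psi x - dphi j i x)
                          (fun x => partial i psi x - dphi j i x) <= eta ^+ 2].
  have [->|j0] := posnP j; first by exists (cst 0).
  have [psi Hpsi] := H10_approx Oopen OV (phi_H10 j0) (exprn_gt0 2 e0).
  by exists psi.
have [psi Hpsi] := choice approx.
(* A radius beyond which the spectral inequality holds for the [j]-th
   approximation. *)
have radius j : exists r : R, (0 < j)%N -> 0 < r /\ forall w, 0 < w -> r <= pi / w ->
    forall Y e : R, 0 <= Y -> 0 < e -> exists N0 : nat, forall N, (N0 <= N)%N -> (0 < N)%N ->
    Y * \int[leb2]_(x in Omega) (psi j x ^+ 2) -
      \sum_i \int[leb2]_(x in Omega) (partial i (psi j) x ^+ 2) <=
    ((2 * pi / w) ^+ 2)^-1 * (N%:R ^- 2 * \sum_(p : 'I_N * 'I_N) \sum_(q : 'I_N * 'I_N)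
       Num.max 0 (Y - w ^+ 2 * sqn (index_diff p q)) *
       power Omega (psi j) (freq w (index_diff p q))) + e.
  have [->|j0] := posnP j; first by exists 0.
  have [tpsi _ _] := Hpsi _ j0; have [r r0 Hr] := test_function_spectral tpsi.
  by exists r.
have [rr Hrr] := choice radius.
pose rmax := \sum_(1 <= j < k.+1) rr j.
have rmax_ge j : (0 < j <= k)%N -> rr j <= rmax.
  move=> /andP[j0 jk]; rewrite /rmax (@big_rem _ _ _ _ _ j)/=; last by rewrite mem_index_iota j0 ltnS.
  rewrite lerDl big_seq sumr_ge0// => i /mem_rem.
  by rewrite mem_index_iota => /andP[/Hrr[/ltW]].
have rmax0 : 0 <= rmax.
  by apply: le_trans (rmax_ge 1%N _); rewrite ?k0//; have [/ltW] := Hrr 1%N isT.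
(* For this step the torus contains the supports of the [k] approximations. *)
pose w := Num.min eta (pi / (rmax + 1)).
have w0 : 0 < w by rewrite lt_min e0 divr_gt0// ltr_wpDl.
have we : w <= eta by rewrite ge_min lexx.
have w1 : w <= 1 by exact: le_trans e1.
have wr : rmax <= pi / w.
  rewrite ler_pdivlMr//; have : w <= pi / (rmax + 1) by rewrite ge_min lexx orbT.
  by rewrite ler_pdivlMr ?ltr_wpDl// mulrDr mulr1 mulrC => h; apply: le_trans h; rewrite lerDl ltW.
have w20 : 0 < w ^+ 2 by rewrite exprn_gt0.
have w21 : w ^+ 2 <= w by rewrite expr2 -[leRHS]mulr1 ler_pM2l.
(* [w^2 m <= Y] exactly when [m < M], so [M] cuts the lattice sum off. *)
pose M := (Num.truncn (Y / w ^+ 2)).+1.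
have hM1 m : (m < M)%N -> w ^+ 2 * m%:R <= Y.
  move=> mM; rewrite mulrC -ler_pdivlMr//.
  by apply: (@le_trans _ _ (Num.truncn (Y / w ^+ 2))%:R);
    rewrite ?ler_nat// truncn_le// divr_ge0// ltW.
have hM2 m : (M <= m)%N -> Y <= w ^+ 2 * m%:R.
  move=> Mm; rewrite [leRHS]mulrC -ler_pdivrMr//.
  by apply: (le_trans (ltW (truncnS_gt _))); rewrite ler_nat.
have hM3 : w ^+ 2 * M%:R <= Y + 1.
  rewrite /M -natr1 mulrDr mulr1 lerD ?(le_trans w21)//.
  exact: hM1.
pose W m := Num.max 0 (Y - w ^+ 2 * m%:R).
have W0 m : 0 <= W m by rewrite le_max lexx.
have WY m : W m <= Y by rewrite ge_max (ltW Y0) lerBlDr lerDl mulr_ge0// ltW.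
(* The first term of [g] comes from the transforms of the eigenfunctions, the second
   one from the error of approximation. *)
pose g m := weight Y L (w ^+ 2 * m%:R) + 2 * k%:R * eta * W m.
have ke0 : 0 <= 2 * k%:R * eta by rewrite !mulr_ge0// ltW.
have le_w2 m : w ^+ 2 * m%:R <= w ^+ 2 * m.+1%:R by rewrite ler_pM2l// ler_nat.
have gd m : g m.+1 <= g m.
  rewrite lerD ?weight_anti// ler_wpM2l// ge_max !le_max lexx/=.
  by rewrite lerD2l lerN2 le_w2 orbT.
have WM m : (M <= m)%N -> W m = 0.
  by move=> /hM2 h; apply/eqP; rewrite eq_le W0 andbT ge_max lexx subr_le0.
have gM m : (M <= m)%N -> g m = 0.
  by move=> Mm; rewrite /g WM// mulr0 addr0 /weight -/(W m) WM// mul0r.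
have g0 : g 0%N = Y * (1 + 2 * k%:R * eta).
  by rewrite /g /W /weight mulr0 subr0 (ltW L0) max_r ?(ltW Y0)//; ring.
have gsum : w ^+ 2 * \sum_(1 <= m < M) g m <= I + eta * (2 * k%:R * Y * (Y + 1)).
  rewrite big_split /= -big_distrr /= mulrDr lerD//.
    exact: weight_sum_le.
  rewrite (_ : _ * _ = 2 * k%:R * eta * (w ^+ 2 * \sum_(1 <= m < M) W m)); last by ring.
  rewrite (_ : eta * _ = 2 * k%:R * eta * ((Y + 1) * Y)); last by ring.
  rewrite ler_wpM2l//.
  apply: (@le_trans _ _ (w ^+ 2 * \sum_(1 <= m < M) Y)).
    by rewrite ler_pM2l// ler_sum.
  rewrite sumr_const_nat -mulr_natl mulrA ler_pM2r//.
  apply: le_trans hM3; rewrite ler_pM2l// ler_nat; exact: leq_subr.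
pose B := pi * \sum_(1 <= m < M) g m + (4 * Num.sqrt M%:R + 1) * g 0%N.
have hB : w ^+ 2 * B <= pi * I + eta * A.
  have hs : w ^+ 2 * (4 * Num.sqrt M%:R + 1) <= eta * (2 * Y + 5).
    have h1 : 2 * (w * Num.sqrt M%:R) <= w ^+ 2 * M%:R + 1.
      have := sqr_ge0 (w * Num.sqrt M%:R - 1).
      by rewrite sqrrB1 exprMn sqr_sqrtr// -mulr_natl; lra.
    rewrite (_ : w ^+ 2 * _ = w * (2 * (2 * (w * Num.sqrt M%:R)) + w)); last by ring.
    have wM0 : 0 <= w * Num.sqrt M%:R by rewrite mulr_ge0 ?sqrtr_ge0// ltW.
    apply: ler_pM => //; first exact: ltW.
      by apply: addr_ge0; [apply: mulr_ge0 => //; apply: mulr_ge0|exact: ltW].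
    by move: h1 hM3 w1; set u := w * Num.sqrt _; set v := w ^+ 2 * _; lra.
  rewrite (_ : w ^+ 2 * B = pi * (w ^+ 2 * \sum_(1 <= m < M) g m) +
    w ^+ 2 * (4 * Num.sqrt M%:R + 1) * g 0%N); last by rewrite /B; ring.
  rewrite (_ : pi * I + _ = pi * (I + eta * (2 * k%:R * Y * (Y + 1))) +
    eta * (2 * Y + 5) * (Y * (1 + 2 * k%:R))); last by rewrite /A; ring.
  apply: lerD; first by rewrite ler_pM2l.
  apply: ler_pM => //.
  - by rewrite mulr_ge0 ?addr_ge0 ?mulr_ge0 ?sqrtr_ge0// ltW.
  - by rewrite g0 mulr_ge0 ?addr_ge0// ltW.
  - rewrite g0 ler_pM2l// lerD2l -[leRHS]mulr1 ler_wpM2l// mulr_ge0//.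
have A0 : 0 <= A.
  have Y0' := ltW Y0.
  by rewrite /A; repeat first [by []|exact: ltW|apply: addr_ge0|apply: mulr_ge0].
(* The parameter [N] of the Fejer kernel is taken large for the [k] approximations
   at once. *)
have threshold j : exists N0 : nat, (0 < j <= k)%N -> forall N, (N0 <= N)%N -> (0 < N)%N ->
    Y * \int[leb2]_(x in Omega) (psi j x ^+ 2) -
      \sum_i \int[leb2]_(x in Omega) (partial i (psi j) x ^+ 2) <=
    ((2 * pi / w) ^+ 2)^-1 * (N%:R ^- 2 * \sum_(p : 'I_N * 'I_N) \sum_(q : 'I_N * 'I_N)
       Num.max 0 (Y - w ^+ 2 * sqn (index_diff p q)) *
       power Omega (psi j) (freq w (index_diff p q))) + eta.
  have [/[dup] jk /andP[j0 _]|] := boolP (0 < j <= k)%N; last by exists 0%N.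
  have [_ Hr] := Hrr _ j0.
  have [N0 HN0] := Hr w w0 (le_trans (rmax_ge _ jk) wr) Y eta (ltW Y0) e0.
  by exists N0.
have [NN HNN] := choice threshold.
pose N := (\sum_(1 <= j < k.+1) NN j).+1.
have NN_le j : (0 < j <= k)%N -> (NN j <= N)%N.
  move=> /andP[j0 jk]; rewrite /N (@big_rem _ _ _ _ _ j)/=; last by rewrite mem_index_iota j0 ltnS.
  exact: leqW (leq_addr _ _).
pose area : R := (2 * pi / w) ^+ 2.
have area_gt0 : 0 < area by rewrite exprn_gt0// divr_gt0// mulr_gt0.
pose S xi := \sum_(1 <= j < k.+1) power Omega (phi j) xi.
(* The two Bessel bounds together. *)
have WS n : W (nsq n) * S (freq w n) <= V * weight Y L (w ^+ 2 * (nsq n)%:R).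
  rewrite /weight -/(W _) mulrCA; apply: ler_wpM2l => //.
  case: ifPn => [_|]; first by rewrite mulr1; exact: (sum_power_le_V Oopen OV phi_on phi_H10).
  rewrite -ltNge => Lt; have t0 := lt_trans L0 Lt.
  rewrite mulrA ler_pdivlMr// mulrC.
  have := sum_power_le_lambda Oopen OV lambda_gt0 lambda_le phi_H10 dphi_on (freq w n) k0.
  by rewrite [X in X * _](_ : _ = w ^+ 2 * (nsq n)%:R)// -sqnE -sqr_norm_freq.
have WP n : W (nsq n) * \sum_(1 <= j < k.+1) power Omega (psi j) (freq w n) <=
    (1 + eta) * V * g (nsq n).
  have : \sum_(1 <= j < k.+1) power Omega (psi j) (freq w n) <=
      (1 + eta) * S (freq w n) + k%:R * (2 * V * (eta * (1 + eta))).
    rewrite /S big_distrr /= -[X in _ + X * _](_ : \sum_(1 <= j < k.+1) 1 = k%:R :> R); last first.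
      by rewrite sumr_const_nat subSS subn0.
    rewrite big_distrl -big_split /=; apply: ler_sum_nat => j /andP[j0 _].
    have [tpsi h0 _] := Hpsi _ j0.
    have [Lu _] := eigen_L2 (phi_H10 j0); have [Lp _] := L2_test_function Oopen OV tpsi.
    apply: (le_trans (power_le_split Oopen OV _ e0 Lp Lu)); rewrite lerD2l mul1r.
    rewrite (_ : 2 * V * (eta * (1 + eta)) = (1 + eta^-1) * (2 * V * eta ^+ 2)); last first.
      by field; rewrite gt_eqF.
    by rewrite ler_wpM2l ?addr_ge0 ?invr_ge0 ?(ltW e0)// ler_wpM2l// mulr_ge0.
  move=> /(ler_wpM2l (W0 (nsq n))) /le_trans; apply.
  have := ler_wpM2l (_ : 0 <= 1 + eta) (WS n) => /(_ (addr_ge0 ler01 (ltW e0))).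
  rewrite /g; set a := weight _ _ _; set b := W _; set c := S _ => h.
  rewrite (_ : b * _ = (1 + eta) * (b * c) + (1 + eta) * V * (2 * k%:R * eta * b)); last by ring.
  by rewrite mulrDr lerD2r -mulrA.
have tot : \sum_(1 <= j < k.+1) (Y * \int[leb2]_(x in Omega) (psi j x ^+ 2) -
      \sum_i \int[leb2]_(x in Omega) (partial i (psi j) x ^+ 2)) <=
    area^-1 * ((1 + eta) * V * B) + k%:R * eta.
  apply: (@le_trans _ _ (\sum_(1 <= j < k.+1) (area^-1 * (N%:R ^- 2 *
       \sum_(p : 'I_N * 'I_N) \sum_(q : 'I_N * 'I_N) W (nsq (index_diff p q)) *
       power Omega (psi j) (freq w (index_diff p q))) + eta))).
    apply: ler_sum_nat => j jk.
    apply: (le_trans (HNN _ jk N (NN_le _ jk) isT)).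
    by under eq_bigr do under eq_bigr do rewrite sqnE.
  rewrite big_split /= sumr_const_nat subSS subn0 mulr_natl lerD2r.
  rewrite -big_distrr /= ler_pM2l ?invr_gt0// -big_distrr /=.
  rewrite exchange_big /=; under eq_bigr do rewrite exchange_big /=.
  under eq_bigr do under eq_bigr do rewrite -big_distrr /=.
  apply: (@le_trans _ _ (N%:R ^- 2 * \sum_(q : 'I_N * 'I_N) \sum_(p : 'I_N * 'I_N)
     (1 + eta) * V * g (nsq (index_diff p q)))).
    rewrite ler_wpM2l ?invr_ge0 ?exprn_ge0// [leRHS]exchange_big /=.
    by apply: ler_sum => p _; apply: ler_sum => q _; exact: WP.
  apply: (@le_trans _ _ (N%:R ^- 2 * \sum_(q : 'I_N * 'I_N) (1 + eta) * V * B)).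
    rewrite ler_wpM2l ?invr_ge0 ?exprn_ge0//; apply: ler_sum => q _.
    rewrite -big_distrr /= ler_wpM2l ?mulr_ge0 ?addr_ge0 ?(ltW e0)//.
    exact: lattice_sum_le.
  rewrite sumr_const card_prod card_ord -[X in _ * X <= _]mulr_natl natrM mulrA -expr2 mulVf ?mul1r//.
  by rewrite expf_neq0// pnatr_eq0.
have low : k%:R * (Y - L - eta * (3 * Y + L + 4)) <=
    \sum_(1 <= j < k.+1) (Y * \int[leb2]_(x in Omega) (psi j x ^+ 2) -
      \sum_i \int[leb2]_(x in Omega) (partial i (psi j) x ^+ 2)).
  rewrite -[X in X * _](_ : \sum_(1 <= j < k.+1) 1 = k%:R :> R); last first.
    by rewrite sumr_const_nat subSS subn0.
  rewrite big_distrl /=; apply: ler_sum_nat => j /andP[j0 jk].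
  have [tpsi h0 hi] := Hpsi _ j0.
  have pj : inner Omega (phi j) (phi j) = 1 by rewrite phi_on// eqxx.
  have dj : \sum_(l < 2) inner Omega (dphi j l) (dphi j l) = lambda j.
    by rewrite dphi_on// eqxx mul1r.
  have [l1 l2] := approx_form (phi_H10 j0) pj dj e0 e1 tpsi h0 hi.
  have l3 : (1 + eta) * lambda j <= (1 + eta) * L.
    by rewrite ler_wpM2l ?addr_ge0 ?(ltW e0)// lambda_le.
  have := ler_wpM2l (ltW Y0) l1; rewrite mul1r => l4.
  rewrite (_ : Y - L - _ = Y * (1 - 3 * eta) - ((1 + eta) * L + 4 * eta)); last by ring.
  by apply: lerB => //; apply: (le_trans l2); rewrite lerD2r.
have fin : area^-1 * ((1 + eta) * V * B) <= V / (4 * pi ^+ 2) * (pi * I + eta * (pi * I + 2 * A)).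
  rewrite (_ : area^-1 * _ = V / (4 * pi ^+ 2) * ((1 + eta) * (w ^+ 2 * B))); last first.
    exact: norm_const.
  have c0 : 0 <= V / (4 * pi ^+ 2) by rewrite divr_ge0// mulr_ge0// sqr_ge0.
  rewrite ler_wpM2l//; apply: (@le_trans _ _ ((1 + eta) * (pi * I + eta * A))).
    by rewrite ler_wpM2l// addr_ge0// ltW.
  rewrite -subr_ge0 (_ : _ - _ = A * (eta * (1 - eta))); last by ring.
  by rewrite mulr_ge0// mulr_ge0 ?subr_ge0// ltW.
have := le_trans (le_trans low tot) (lerD fin (lexx _)).
rewrite -subr_ge0 => h; rewrite -subr_ge0 /C; apply: (le_trans h).
by rewrite le_eqVlt; apply/orP; left; apply/eqP; exact: final_const.
Qed.

End EigenvalueInequality.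

(** * Numerical bounds and conclusion *)

Section ExpBounds.
Context {R : realType}.
Implicit Types x z : R.

(** The sum of [x^i k! / (k + i)!] for [i < n], plus [x^n k! / (k + n)! z], in
Horner form.  Factorials do not appear, so that the value at a rational point
can be computed. *)
Fixpoint exp_horner (n k : nat) x z : R :=
  if n is n'.+1 then 1 + x / k.+1%:R * exp_horner n' k.+1 x z else z.

Lemma exp_hornerE n x z : exp_horner n 0 x z =
  \sum_(0 <= i < n) x ^+ i / i`!%:R + x ^+ n / n`!%:R * z.
Proof.
have E k : k`!%:R != 0 :> R by rewrite pnatr_eq0 -lt0n fact_gt0.
suff H k : x ^+ k / k`!%:R * exp_horner n k x z =
    \sum_(k <= i < k + n) x ^+ i / i`!%:R + x ^+ (k + n) / (k + n)`!%:R * z.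
  by have := H 0%N; rewrite expr0 fact0 divr1 mul1r !add0n.
elim: n k => [|n ih] k; first by rewrite addn0 big_geq// add0r.
rewrite /= big_ltn ?addnS ?ltnS ?leq_addr// -addSn -addrA -ih factS natrM exprS.
field; by rewrite E addrC natr1 pnatr_eq0.
Qed.

Lemma exp_horner_homo n x z z' : 0 <= x -> z <= z' ->
  exp_horner n 0 x z <= exp_horner n 0 x z'.
Proof.
by move=> x0 zz; rewrite !exp_hornerE lerD2l ler_wpM2l// divr_ge0// exprn_ge0.
Qed.

Lemma exp_horner_le n x : 0 <= x -> exp_horner n 0 x 0 <= expR x.
Proof.
move=> x0; rewrite exp_hornerE mulr0 addr0.
apply: (@nondecreasing_cvgn_le _ (series (exp_coeff x))).
- apply/nondecreasing_seqP => m; rewrite /series /= big_nat_recr//= lerDl.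
  by rewrite divr_ge0// exprn_ge0.
- exact: is_cvg_series_exp_coeff.
Qed.

(** The tail of the exponential series from the rank [n] on is at most
[x^n / n!] times the geometric series of ratio [x]. *)
Lemma le_exp_horner n x : 0 <= x -> x < 1 -> expR x <= exp_horner n 0 x (1 - x)^-1.
Proof.
move=> x0 x1; have x10 : 0 < 1 - x by rewrite subr_gt0.
have E k : k`!%:R != 0 :> R by rewrite pnatr_eq0 -lt0n fact_gt0.
have t0 i : 0 <= x ^+ i / i`!%:R by rewrite divr_ge0// exprn_ge0.
have step m : exp_horner m.+1 0 x (1 - x)^-1 <= exp_horner m 0 x (1 - x)^-1.
  rewrite !exp_hornerE big_nat_recr//= -addrA lerD2l.
  rewrite (_ : x ^+ m.+1 / m.+1`!%:R = x ^+ m / m`!%:R * (x / m.+1%:R)); last first.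
    by rewrite factS natrM exprS; field; rewrite E addrC natr1 pnatr_eq0.
  rewrite -mulrA -{1}[x ^+ m / _]mulr1 -mulrDr ler_wpM2l//.
  rewrite -(ler_pM2r x10) mulrDl mul1r mulfVK ?gt_eqF// mulVf ?gt_eqF//.
  rewrite -lerBrDl opprB addrCA subrr addr0 ler_pdivrMr// ler_peMr//.
  by rewrite ler1n.
have mono m : (n <= m)%N -> exp_horner m 0 x (1 - x)^-1 <= exp_horner n 0 x (1 - x)^-1.
  elim: m => [|m ih]; first by rewrite leqn0 => /eqP ->.
  rewrite leq_eqVlt => /orP[/eqP -> //|/ih h]; exact: le_trans (step m) h.
apply: limr_le; first exact: is_cvg_series_exp_coeff.
near=> m; apply: le_trans (mono m _); last by near: m; exact: nbhs_infty_ge.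
by rewrite exp_hornerE /series /= lerDl mulr_ge0// invr_ge0 ltW.
Unshelve. all: by end_near.
Qed.

(** Strict monotonicity of [y - log y] beyond 1. *)
Lemma ln_gap (a b : R) : 1 < a -> a < b -> a - ln a < b - ln b.
Proof.
move=> a1 ab; have a0 : 0 < a by exact: lt_trans a1.
have b0 : 0 < b by exact: lt_trans ab.
have : ln (1 + (b / a - 1)) <= b / a - 1.
  by apply: le_ln1Dx; rewrite ltrBrDl subrr divr_gt0.
rewrite addrC subrK ln_div ?posrE//.
have : b / a - 1 < b - a.
  rewrite (_ : b / a - 1 = (b - a) / a); last by field; rewrite gt_eqF.
  by rewrite ltr_pdivrMr// ltr_pMr// subr_gt0.
lra.
Qed.

(* The decimal numbers 2.357676673700 and 2.357676673949.  The threshold is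
   2.3576766739459 up to rounding; the upper bound has to be this close because the
   constant is 0.538306807651 up to 12 digits, very near the middle of two consecutive
   decimal numbers with 10 digits. *)
Let lo : R := 2 + 357 / 10 ^+ 3 + 676 / 10 ^+ 6 + 673 / 10 ^+ 9 + 700 / 10 ^+ 12.
Let hi : R := 2 + 357 / 10 ^+ 3 + 676 / 10 ^+ 6 + 673 / 10 ^+ 9 + 949 / 10 ^+ 12.

Lemma lo_lt : lo - ln lo < 3 / 2.
Proof.
have lo0 : 0 < lo by rewrite /lo; lra.
suff : expR (lo - 3 / 2) < lo.
  rewrite -{2}(lnK (x := lo)) ?posrE// ltr_expR; lra.
have l0 : 0 <= lo - 3 / 2 by rewrite /lo; lra.
have l1 : lo - 3 / 2 < 1 by rewrite /lo; lra.
have l8 : (1 - (lo - 3 / 2))^-1 <= 8.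
  by rewrite -[leLHS]mul1r ler_pdivrMr ?subr_gt0// /lo; lra.
apply: (le_lt_trans (le_exp_horner 15 l0 l1)).
apply: (le_lt_trans (exp_horner_homo 15 l0 l8)).
rewrite /exp_horner /lo.
lra.
Qed.

Lemma hi_gt : 3 / 2 < hi - ln hi.
Proof.
have hi0 : 0 < hi by rewrite /hi; lra.
suff : hi < expR (hi - 3 / 2).
  rewrite -{1}(lnK (x := hi)) ?posrE// ltr_expR; lra.
have l0 : 0 <= hi - 3 / 2 by rewrite /hi; lra.
apply: (lt_le_trans _ (exp_horner_le 16 l0)).
rewrite /exp_horner /hi.
lra.
Qed.

Lemma bracket (y : R) : 1 < y -> y - ln y = 3 / 2 -> lo < y < hi.
Proof.
move=> y1 yE; have lo1 : 1 < lo by rewrite /lo; lra.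
have hi1 : 1 < hi by rewrite /hi; lra.
apply/andP; split; rewrite ltNge; apply/negP => h.
- have := lo_lt; rewrite -yE; move: h; rewrite le_eqVlt => /orP[/eqP ->|h].
    by rewrite ltxx.
  by have := ln_gap y1 h; lra.
- have := hi_gt; rewrite -yE; move: h; rewrite le_eqVlt => /orP[/eqP ->|h].
    by rewrite ltxx.
  by have := ln_gap hi1 h; lra.
Qed.

Lemma threshold_exists : exists y : R, 1 < y /\ y - ln y = 3 / 2.
Proof.
have lo1 : 1 < lo by rewrite /lo; lra.
have lohi : lo <= hi by rewrite /lo /hi; lra.
pose F (y : R) := y - ln y.
have cF : {within `[lo, hi], continuous F}.
  apply/continuous_in_subspaceT => y; rewrite inE /= in_itv /= => /andP[loy _].
  apply: cvgB; first exact: cvg_id.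
  by apply: continuous_ln; exact: lt_le_trans (lt_trans ltr01 lo1) loy.
have h1 := ltW lo_lt; have h2 := ltW hi_gt.
have [|c] := IVT lohi cF (v := 3 / 2).
  by rewrite ge_min le_max h1 h2 orbT.
rewrite in_itv /= => /andP[loc _] Fc; exists c; split => //.
exact: lt_le_trans loc.
Qed.

Lemma threshold_unique (y z : R) : 1 < y -> 1 < z ->
  y - ln y = 3 / 2 -> z - ln z = 3 / 2 -> y = z.
Proof.
move=> y1 z1 yE zE; have [//|yz] := eqVneq y z; have [h|h] := ltP y z.
  by have := ln_gap y1 h; rewrite yE zE ltxx.
have h' : z < y by rewrite lt_neqAle eq_sym yz.
by have := ln_gap z1 h'; rewrite yE zE ltxx.
Qed.

Let lt_inv (K a : R) : 0 < K -> a * K < 1 -> a < K^-1.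
Proof. by move=> K0; rewrite -[X in _ -> _ < X]mul1r ltr_pdivlMr. Qed.

Let inv_lt (K a : R) : 0 < K -> 1 < a * K -> K^-1 < a.
Proof. by move=> K0; rewrite -[X in _ -> X < _]mul1r ltr_pdivrMr. Qed.

(** The constant lies between 0.538306807650 and 0.538306807750. *)
Lemma constant_bounds (y : R) : 1 < y -> y - ln y = 3 / 2 ->
  [/\ 1 < y - 1 / 2,
      `|(y - 1 / 2)^-1 - (538 / 10 ^+ 3 + 306 / 10 ^+ 6 + 807 / 10 ^+ 9 + 7 / 10 ^+ 10)|
        <= 1 / 2 / 10 ^+ 10,
      1 / 2 < (y - 1 / 2)^-1 &
      `|(y - 1 / 2)^-1 / (1 / 2) - 1 - 766 / 10 ^+ 4| <= 1 / 2 / 10 ^+ 4].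
Proof.
move=> y1 /(bracket y1)/andP[+ +]; rewrite /lo /hi => loy yhi.
have K1 : 1 < y - 1 / 2 by lra.
have K0 : 0 < y - 1 / 2 by lra.
have c_lo : 538 / 10 ^+ 3 + 306 / 10 ^+ 6 + 807 / 10 ^+ 9 + 650 / 10 ^+ 12 < (y - 1 / 2)^-1.
  by apply: (lt_inv K0); lra.
have c_hi : (y - 1 / 2)^-1 < 538 / 10 ^+ 3 + 306 / 10 ^+ 6 + 807 / 10 ^+ 9 + 750 / 10 ^+ 12.
  by apply: (inv_lt K0); lra.
move: c_lo c_hi; move: (y - 1 / 2)^-1 => c c_lo c_hi.
by split => //; rewrite ?ler_norml; lra.
Qed.

End ExpBounds.

(** The weighted inequality at [Y = y * lambda k], where the antiderivative takes
the value [(lambda k)^2 (y - 1/2) (y - 1)] because [log y = y - 3/2]. *)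
Lemma eigenvalue_index_le (R : realType) (Omega : set (R * R)) (V : R)
    (Omega_open : open Omega) (V_gt0 : 0 < V) (V_def : leb2 Omega = V%:E)
    (lambda : nat -> R) (lambda_spec : dirichlet_eigenvalues Omega lambda)
    (y : R) (k : nat) : 1 < y -> y - ln y = 3 / 2 -> (0 < k)%N ->
  k%:R <= V * lambda k / (4 * pi) * (y - 1 / 2).
Proof.
move=> y1 yE k0; case: lambda_spec => l0 lle _ [phi [dphi [[phiL2 phi_on _] eig]]].
have phi_H10 j : (0 < j)%N -> H10 Omega (phi j) (dphi j) by case/eig.
have dphi_on i j : (0 < i)%N -> (0 < j)%N ->
    \sum_(l < 2) inner Omega (dphi i l) (dphi j l) = (i == j)%:R * lambda i.
  move=> i0 j0; have [Hi Ei] := eig i i0; have Hj := phi_H10 j j0.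
  have := Ei _ _ Hj; rewrite phi_on// mulrC => <-.
  have [_ Li] := eigen_L2 Hi; have [_ Lj] := eigen_L2 Hj.
  have ip l := L2_mul_integrable Omega_open (Li l) (Lj l).
  rewrite big_ord_recl big_ord1 /inner -RintegralD//; last exact: measurable_Omega.
  by apply: eq_Rintegral => x _; rewrite big_ord_recl big_ord1.
have L0 : 0 < lambda k by exact: l0.
have LY : lambda k <= y * lambda k by rewrite ler_peMl// ltW.
have := eigenvalue_weight_le Omega_open V_def l0 lle phi_on phi_H10 dphi_on k0 LY.
have -> : weight_prim (y * lambda k) (lambda k) (y * lambda k) =
    lambda k ^+ 2 * ((y - 1 / 2) * (y - 1)).
  rewrite /weight_prim ifF; last by apply/negbTE; rewrite -ltNge ltr_pMl.
  rewrite lnM ?posrE//; last exact: lt_trans y1.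
  rewrite (_ : ln y = y - 3 / 2); last by rewrite -yE; ring.
  by field.
rewrite (_ : k%:R * _ = k%:R * ((y - 1) * lambda k)); last by ring.
rewrite (_ : _ * (lambda k ^+ 2 * _) =
  V * lambda k / (4 * pi) * (y - 1 / 2) * ((y - 1) * lambda k)); last by ring.
by rewrite ler_pM2r// mulr_gt0// subr_gt0.
Qed.

Theorem theorem4p2 (R : realType) (Omega : set (R * R)) (V : R)
    (Omega_open : open Omega) (V_gt0 : 0 < V) (V_def : leb2 Omega = V%:E)
    (lambda : nat -> R) (lambda_spec : dirichlet_eigenvalues Omega lambda) :
  (exists! y : R, 1 < y /\ y - ln y = 3 / 2) /\
  (forall y2 : R, 1 < y2 -> y2 - ln y2 = 3 / 2 ->
   let K2 := 1 + ln y2 in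
   let c2 := K2^-1 in
   [/\ K2 = y2 - 1 / 2,
       forall k : nat, (1 <= k)%N -> c2 * (4 * pi * k%:R / V) <= lambda k,
       `|c2 - (538 / 10 ^+ 3 + 306 / 10 ^+ 6 + 807 / 10 ^+ 9 + 7 / 10 ^+ 10)|
         <= 1 / 2 / 10 ^+ 10,
       forall k : nat,
         2 * pi * k%:R / V = 1 / 2 * (4 * pi * k%:R / V) &
       1 / 2 < c2 /\
       `|c2 / (1 / 2) - 1 - 766 / 10 ^+ 4| <= 1 / 2 / 10 ^+ 4]).
Proof.
split.
  have [y [y1 yE]] := @threshold_exists R; exists y; split => // z [z1 zE].
  exact: threshold_unique.
move=> y y1 yE K2 c2.
have K2E : K2 = y - 1 / 2 by rewrite /K2; lra.
have [K1 hc h2 h3] := constant_bounds y1 yE.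
rewrite -K2E -/c2 in K1 hc h2 h3.
split => //; last by move=> k; field; rewrite gt_eqF.
move=> k k0; have := eigenvalue_index_le Omega_open V_gt0 V_def lambda_spec y1 yE k0.
rewrite -K2E => h; have K0 : 0 < K2 by exact: lt_trans K1.
have pi0 : 0 < 4 * pi :> R by rewrite mulr_gt0// pi_gt0.
rewrite /c2 ler_pdivrMl// ler_pdivrMr//.
move: h; rewrite [_ / _ * K2]mulrAC ler_pdivlMr// => h.
rewrite (_ : 4 * pi * k%:R = k%:R * (4 * pi)); last by ring.
by apply: (le_trans h); rewrite le_eqVlt; apply/orP; left; apply/eqP; ring.
Qed.
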